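(* Let $(A,B,\ell,g)$ be admissible data which are moreover separable and monotone (see context), let $m_0\in\mathcal P(\mathbb R^d)$ have compact support, let $(N_t,N_s)$ be admissible discretization parameters and let $\varepsilon>0$. Then the discrete MFG problem, i.e. find $M\in\mathcal M$ such that $M=\mathbf{br}(M)$, admits a unique solution.
   Context: **Notation.** $T>0$, $1\le r\le d$ integers, $p\in(1,\infty)$. $|\cdot|$ is the maximum norm on $\mathbb R^n$ and the induced norm on matrices; $\overline{\mathrm B}(x,R)$ is the closed ball for this norm. $\mathcal P(X)$ is the set of Borel probability measures on $X$; $\mathcal P_1(\mathbb R^d)$ those with finite first moment, with the Monge–Kantorovich (Wasserstein-1) metric $d_1$. **Admissible data.** $A:[0,T]\times\mathbb R^d\to\mathbb R^d$, $B:[0,T]\times\mathbb R^d\to\mathbb R^{d\times r}$, $\ell:[0,T]\times\mathbb R^r\times\mathbb R^d\times\mathcal P_1(\mathbb R^d)\to\mathbb R$, $g:\mathbb R^d\times\mathcal P_1(\mathbb R^d)\to\mathbb R$ are continuous and: - (conditions on $\ell$) there are $\underline\ell,\overline\ell,C_\ell>0$ with $\underline\ell|a|^p-C_\ell\le\ell(t,a,x,\mu)\le\overline\ell|a|^p+C_\ell$ for all $(t,a,x,\mu)$; there is $L_\ell>0$ with $|\ell(t,a,x,\mu)-\ell(t,a,y,\mu)|\le L_\ell(1+|a|^p)|x-y|$ for all $t,a,\mu,x,y$; $\ell$ is convex and continuously differentiable in its second argument $a$; - there are $c_g\in\mathbb R$, $L_g>0$ with $g(x,\mu)\ge c_g$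 and $|g(x,\mu)-g(y,\mu)|\le L_g|x-y|$ for all $x,y,\mu$; - there are $L_A,L_B,C_B>0$ with $|A(t,x)-A(t,y)|\le L_A|x-y|$, $|B(t,x)-B(t,y)|\le L_B|x-y|$, $|B(t,x)|\le C_B$ for all $t,x,y$; and there are fixed indices $\{i_1,\dots,i_r\}\subset\{1,\dots,d\}$ such that for all $(t,x)$ the rows $i_1,\dots,i_r$ of $B(t,x)$ are linearly independent. Set $C_A=\max\{\max_{t}|A(t,0)|,L_A\}$. **Separable and monotone data.** $\ell(t,a,x,\mu)=\ell_0(t,a,x)+f(t,x,\mu)$ for all $(t,a,x,\mu)$, where $\ell_0:[0,T]\times\mathbb R^r\times\mathbb R^d\to\mathbb R$ is continuous, there are $\underline\ell_0,\overline\ell_0,C_{\ell_0}>0$ with $\underline\ell_0|a|^p-C_{\ell_0}\le\ell_0(t,a,x)\le\overline\ell_0|a|^p+C_{\ell_0}$ for all $(t,a,x)$, there is $L_{\ell_0}>0$ with $|\ell_0(t,a,x)-\ell_0(t,a,y)|\le L_{\ell_0}(1+|a|^p)|x-y|$ for all $t,a,x,y$, and $\ell_0$ is convex and continuously differentiable in its second argument $a$; and $f:[0,T]\times\mathbb R^d\times\mathcal P_1(\mathbb R^d)\to\mathbb R$ is continuous, bounded, and there is $L_f>0$ with $|f(t,x,\mu)-f(t,y,\mu)|\le L_f|x-y|$ for all $t,\mu,x,y$; moreover $\Phi=g$ and $\Phi=f(t,\cdot,\cdot)$, for every $t\in[0,T]$, satisfy $$\int_{\mathbb R^d}\big(\Phi(x,\mu_1)-\Phi(x,\mu_2)\big)\,d(\mu_1-\mu_2)(x)\ge0\qquad\text{for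 all }\mu_1,\mu_2\in\mathcal P_1(\mathbb R^d).$$ **Constant $\widehat C$.** For $N_t\in\mathbb N$ put $\mathcal I=\{0,\dots,N_t\}$, $\mathcal I^*=\mathcal I\setminus\{N_t\}$, $\Delta t=T/N_t$, $t_k=k\Delta t$. For $m\in C([0,T];\mathcal P_1(\mathbb R^d))$, $k\in\mathcal I^*$, $x\in\mathbb R^d$ and $\alpha=(\alpha_k,\dots,\alpha_{N_t-1})\in(\mathbb R^r)^{N_t-k}$ let $J_{k,x}(\alpha)=\Delta t\sum_{j=k}^{N_t-1}\ell(t_j,\alpha_j,\gamma_j,m(t_j))+g(\gamma_{N_t},m(T))$, with $\gamma_k=x$, $\gamma_{j+1}=\gamma_j+\Delta t(A(t_j,\gamma_j)+B(t_j,\gamma_j)\alpha_j)$. $\widehat C>0$ is a fixed constant such that for all $N_t,m,k,x$ every minimizer $\widehat\alpha$ of $J_{k,x}$ satisfies $\max_j|\widehat\alpha_j|\le\widehat C$ (such a constant exists). **Grid and interpolation.** Coordinates are ordered so that $\{i_1,\dots,i_r\}=\{1,\dots,r\}$. Write $x=(\mathrm x_1,\mathrm x_2)\in\mathbb R^r\times\mathbb R^{d-r}$, $A=(A_1,A_2)$, and $B=\binom{B_1}{B_2}$ with $B_1(t,x)\in\mathbb R^{r\times r}$ invertible. For $N_s\in\mathbb N$ let $\Delta x=1/N_s$, $\mathcal G_r=\Delta x\,\mathbb Z^r$, $\mathcal G_{d-r}=\Delta x\,\mathbb Z^{d-r}$, $\mathcal G=\mathcal G_r\times\mathcal G_{d-r}$.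 $(\beta_{\mathrm x_2})_{\mathrm x_2\in\mathcal G_{d-r}}$ is a $\mathbb Q_1$ finite element basis on a regular mesh of $\mathbb R^{d-r}$ with vertices in $\mathcal G_{d-r}$: each $\beta_{\mathrm x_2}$ is nonnegative, a polynomial of partial degree $\le1$ on each mesh element, $\beta_{\mathrm x_2}(\mathrm x_2)=1$, $\beta_{\mathrm x_2}(\mathrm x_2')=0$ for other vertices $\mathrm x_2'$, $\sum_{\mathrm x_2}\beta_{\mathrm x_2}\equiv1$, and $\operatorname{supp}\beta_{\mathrm x_2}\subset\{\mathrm y_2:|\mathrm y_2-\mathrm x_2|\le C_I\Delta x\}$ with $C_I>0$ independent of $\Delta x$. For $F\subset\mathcal G_{d-r}$ and $\varphi:F\to\mathbb R$, $I_F[\varphi](\mathrm y_2)=\sum_{\mathrm x_2\in F}\beta_{\mathrm x_2}(\mathrm y_2)\varphi(\mathrm x_2)$. **State sets.** Let $K_0=\operatorname{supp}(m_0)$ and $K_{k+1}=K_k+\big(\Delta t[C_A(1+\sup_{x\in K_k}|x|)+C_B\widehat C]+C_I\Delta x\big)\overline{\mathrm B}(0,1)$ for $k\in\mathcal I^*$. There is a compact $K\subset\mathbb R^d$, fixed once and for all, containing all $K_k$ for all $(\Delta t,\Delta x)$ with $\Delta x\le\Delta t$; $c_K>0$ is a constant with $|B_1(t,x)^{-1}|\le c_K$ on $[0,T]\times K$. For $k\in\mathcal I^*$, $x\in\mathcal G$, $\mathrm y_1\in\mathbb R^r$: $$\alpha(k,x,\mathrm y_1)=B_1(t_k,x)^{-1}\Big[\tfrac{\mathrm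 y_1-\mathrm x_1}{\Delta t}-A_1(t_k,x)\Big],\quad \mathbf{y_2}(k,x,\mathrm y_1)=\mathrm x_2+\Delta t[A_2(t_k,x)+B_2(t_k,x)\alpha(k,x,\mathrm y_1)],$$ $\mathcal S^1_{k+1}(x)=\{\mathrm y_1\in\mathcal G_r:|\alpha(k,x,\mathrm y_1)|\le\widehat C\}$, $\mathcal S^2_{k+1}(x,\mathrm y_1)=\{\mathrm y_2\in\mathcal G_{d-r}:\mathbf{y_2}(k,x,\mathrm y_1)\in\operatorname{supp}\beta_{\mathrm y_2}\}$, $\mathcal S_{k+1}(x)=\{(\mathrm y_1,\mathrm y_2):\mathrm y_1\in\mathcal S^1_{k+1}(x),\mathrm y_2\in\mathcal S^2_{k+1}(x,\mathrm y_1)\}$, $\mathcal S_0=\mathcal G\cap K_0$, $\mathcal S_{k+1}=\bigcup_{x\in\mathcal S_k}\mathcal S_{k+1}(x)$. **Admissible discretization parameters.** $(N_t,N_s)$ such that $\Delta x/\Delta t\le\min\{1,\widehat C/c_K\}$ and, with $E(x)=\{y\in\mathbb R^d:|x-y|\le\Delta x/2\}$, $m_0(\partial E(x))=0$ for all $x\in\mathcal G$. **Discrete MFG problem.** Let $\varepsilon>0$, $\mathcal M=\prod_{k\in\mathcal I}\mathcal P(\mathcal S_k)$ (elements of $\mathcal P(\mathcal S_k)$ are identified with finitely supported measures on $\mathbb R^d$), $\mathcal E_F(q)=\sum_{x\in F}q(x)\log q(x)$ ($0\log0=0$). For $M=(M_k)_{k}\in\mathcal M$ let $V^M_{N_t}(x)=g(x,M_{N_t})$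 on $\mathcal S_{N_t}$ and, for $k\in\mathcal I^*$, $x\in\mathcal S_k$, $$V^M_k(x)=\min_{q\in\mathcal P(\mathcal S^1_{k+1}(x))}\Big\{\sum_{\mathrm y_1\in\mathcal S^1_{k+1}(x)}q(\mathrm y_1)\big[\Delta t\,\ell(t_k,\alpha(k,x,\mathrm y_1),x,M_k)+I_{\mathcal S^2_{k+1}(x,\mathrm y_1)}[V^M_{k+1}(\mathrm y_1,\cdot)](\mathbf{y_2}(k,x,\mathrm y_1))\big]+\varepsilon\mathcal E_{\mathcal S^1_{k+1}(x)}(q)\Big\}.$$ Let $p^M_k(x,\cdot)$ be the unique minimizer; $P^M_k(x,y)=p^M_k(x,\mathrm y_1)\beta_{\mathrm y_2}(\mathbf{y_2}(k,x,\mathrm y_1))$ if $y=(\mathrm y_1,\mathrm y_2)\in\mathcal S_{k+1}(x)$, and $0$ if $y\in\mathcal S_{k+1}\setminus\mathcal S_{k+1}(x)$. The best response mapping $\mathbf{br}:\mathcal M\to\mathcal M$ is $\mathbf{br}(M)=\widehat M$ with $\widehat M_0(x)=m_0(E(x))$ for $x\in\mathcal S_0$, and $\widehat M_{k+1}(y)=\sum_{x\in\mathcal S_k}P^M_k(x,y)\widehat M_k(x)$ for $k\in\mathcal I^*$, $y\in\mathcal S_{k+1}$.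
   Formalization: Additionally assumes that the initial weights m_0(E(x)), x in S_0 = G ∩ supp(m_0), sum to 1, so that br maps into M; otherwise (e.g. m_0 a Dirac mass at a non-grid point inside a cell, where S_0 is empty) no solution exists. *)

(* Defs.v *)
From HB Require Import structures.
From mathcomp Require Import all_boot all_order all_algebra.
From mathcomp Require Import all_classical all_reals all_analysis.

Set Implicit Arguments.
Unset Strict Implicit.
Unset Printing Implicit Defensive.

Import Order.TTheory GRing.Theory Num.Theory.
Import numFieldNormedType.Exports.

Local Open Scope classical_set_scope.
Local Open Scope ring_scope.

(** Conventions.
    - R^n is ['cV[R]_n]; the library norm [`|x|] on it is the maximum norm.
      On a matrix the library norm is the largest entry, so the induced norm
      is [opnorm] below.
    - The state dimension is d = r + s, and the coordinates are ordered so that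
      i_1, ..., i_r are the first r ones: x = col_mx x_1 x_2, [usubmx] and
      [dsubmx] are the two components of a vector and the two row blocks of a
      matrix.
    - Functions of t in [0, T] and of a measure in P_1 are total functions; the
      assumptions on them only concern t in [0, T] and measures in P_1. *)

Section Measures.
Context {R : realType}.

Definition borel (n : nat) := g_sigma_algebraType (@open 'cV[R]_n).

Definition prob (n : nat) := probability (borel n) R.

Definition in_P1 n (mu : prob n) : Prop :=
  (\int[mu]_(x in setT) (`|(x : 'cV[R]_n)|)%:E < +oo)%E.

Definition coupling n (mu nu : prob n)
    (pi : probability (borel n * borel n)%type R) : Prop :=
  forall X : set (borel n), measurable X ->
    pi (X `*` setT) = mu X /\ pi (setT `*` X) = nu X.

(* The Monge-Kantorovich (Wasserstein-1) distance. *)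
Definition d1 n (mu nu : prob n) : \bar R :=
  ereal_inf [set (\int[pi]_(z in setT) (`|(z.1 : 'cV[R]_n) - z.2|)%:E)%E
            | pi in coupling mu nu].

Definition msupp n (mu : prob n) : set 'cV[R]_n :=
  [set x | forall U : set 'cV[R]_n, open U -> U x -> (0 < mu U)%E].

(* Weights q : R^n -> R of a probability measure carried by F.  The sum is a
   sum over the x in F with q x != 0; it is 0 if there are infinitely many. *)
Definition in_P n (F : set 'cV[R]_n) (q : 'cV[R]_n -> R) : Prop :=
  [/\ forall x, 0 <= q x, forall x, ~ F x -> q x = 0
    & \sum_(x \in F) q x = 1].

(* The measure sum_x w(x) delta_x; irrelevant default value when w is not the
   family of weights of a finitely supported probability measure. *)
Definition measure_of n (w : 'cV[R]_n -> R) : prob n :=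
  xget (\d_(0 : borel n) : prob n)
    [set mu : prob n | forall X : set (borel n), measurable X ->
       mu X = (\sum_(x \in (X : set 'cV[R]_n)) w x)%:E].

End Measures.

Arguments prob : clear implicits.

Section Data.
Context {R : realType}.
Variables (T p : R) (r s : nat).

Let D := 'cV[R]_(r + s).

Definition opnorm m n (X : 'M[R]_(m, n)) : R :=
  sup [set `|X *m a| | a in [set a : 'cV[R]_n | `|a| <= 1]].

Definition C1_convex n (F : 'cV[R]_n -> R) : Prop :=
  [/\ convex_function setT F, forall a, differentiable F a
    & forall v, continuous (fun a => 'D_v F a)].

Definition monotone_cost (Phi : D -> prob R (r + s) -> R) : Prop :=
  forall mu1 mu2 : prob R (r + s), in_P1 mu1 -> in_P1 mu2 ->
  0 <= \int[mu1]_(x in setT) (Phi x mu1 - Phi x mu2)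
       - \int[mu2]_(x in setT) (Phi x mu1 - Phi x mu2).

Record dynamics_hyp (A : R -> D -> D) (B : R -> D -> 'M[R]_(r + s, r))
    (LA CB : R) : Prop := {
  A_continuous : {within [set z : R * D | 0 <= z.1 <= T],
                   continuous (fun z => A z.1 z.2)};
  B_continuous : {within [set z : R * D | 0 <= z.1 <= T],
                   continuous (fun z => B z.1 z.2)};
  LA_gt0 : 0 < LA;
  A_lipschitz : forall (t : R) (x y : D), 0 <= t <= T ->
    `|A t x - A t y| <= LA * `|x - y|;
  B_lipschitz : exists2 LB : R, 0 < LB & forall (t : R) (x y : D),
    0 <= t <= T -> opnorm (B t x - B t y) <= LB * `|x - y|;
  CB_gt0 : 0 < CB;
  B_bounded : forall (t : R) (x : D), 0 <= t <= T -> opnorm (B t x) <= CB;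
  (* the first r rows of B(t,x) are linearly independent *)
  B_rows : forall (t : R) (x : D), 0 <= t <= T -> row_free (usubmx (B t x)) }.

Record running_cost_hyp (ell : R -> 'cV[R]_r -> D -> prob R (r + s) -> R)
    : Prop := {
  ell_continuous : forall (t : R) (a : 'cV[R]_r) (x : D) mu,
    0 <= t <= T -> in_P1 mu ->
    forall e : R, 0 < e -> exists2 del : R, 0 < del &
    forall (t' : R) (a' : 'cV[R]_r) (x' : D) mu',
      0 <= t' <= T -> in_P1 mu' ->
      `|t' - t| < del -> `|a' - a| < del -> `|x' - x| < del ->
      (d1 mu' mu < del%:E)%E -> `|ell t' a' x' mu' - ell t a x mu| < e;
  ell_growth : exists lo hi C : R, [/\ 0 < lo, 0 < hi, 0 < C
    & forall (t : R) (a : 'cV[R]_r) (x : D) mu, 0 <= t <= T -> in_P1 mu ->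
        lo * `|a| `^ p - C <= ell t a x mu <= hi * `|a| `^ p + C];
  ell_lipschitz : exists2 L : R, 0 < L &
    forall (t : R) (a : 'cV[R]_r) (x y : D) mu,
    0 <= t <= T -> in_P1 mu ->
    `|ell t a x mu - ell t a y mu| <= L * (1 + `|a| `^ p) * `|x - y|;
  ell_C1_convex : forall (t : R) (x : D) mu, 0 <= t <= T -> in_P1 mu ->
    C1_convex (fun a => ell t a x mu) }.

Record final_cost_hyp (g : D -> prob R (r + s) -> R) : Prop := {
  g_continuous : forall (x : D) mu, in_P1 mu ->
    forall e : R, 0 < e -> exists2 del : R, 0 < del &
    forall (x' : D) mu', in_P1 mu' -> `|x' - x| < del ->
      (d1 mu' mu < del%:E)%E -> `|g x' mu' - g x mu| < e;
  g_bounded_below : exists c : R, forall x mu, in_P1 mu -> c <= g x mu;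
  g_lipschitz : exists2 L : R, 0 < L & forall (x y : D) mu, in_P1 mu ->
    `|g x mu - g y mu| <= L * `|x - y| }.

Record separable_running_cost_hyp (ell0 : R -> 'cV[R]_r -> D -> R) : Prop := {
  ell0_continuous : {within [set z : R * 'cV[R]_r * D | 0 <= z.1.1 <= T],
                      continuous (fun z => ell0 z.1.1 z.1.2 z.2)};
  ell0_growth : exists lo hi C : R, [/\ 0 < lo, 0 < hi, 0 < C
    & forall (t : R) (a : 'cV[R]_r) (x : D), 0 <= t <= T ->
        lo * `|a| `^ p - C <= ell0 t a x <= hi * `|a| `^ p + C];
  ell0_lipschitz : exists2 L : R, 0 < L &
    forall (t : R) (a : 'cV[R]_r) (x y : D),
    0 <= t <= T ->
    `|ell0 t a x - ell0 t a y| <= L * (1 + `|a| `^ p) * `|x - y|;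
  ell0_C1_convex : forall (t : R) x, 0 <= t <= T ->
    C1_convex (fun a => ell0 t a x) }.

Record coupling_cost_hyp (f : R -> D -> prob R (r + s) -> R) : Prop := {
  f_continuous : forall (t : R) (x : D) mu, 0 <= t <= T -> in_P1 mu ->
    forall e : R, 0 < e -> exists2 del : R, 0 < del &
    forall (t' : R) (x' : D) mu', 0 <= t' <= T -> in_P1 mu' ->
      `|t' - t| < del -> `|x' - x| < del ->
      (d1 mu' mu < del%:E)%E -> `|f t' x' mu' - f t x mu| < e;
  f_bounded : exists C : R, forall (t : R) (x : D) mu,
    0 <= t <= T -> in_P1 mu -> `|f t x mu| <= C;
  f_lipschitz : exists2 L : R, 0 < L & forall (t : R) (x y : D) mu,
    0 <= t <= T -> in_P1 mu ->
    `|f t x mu - f t y mu| <= L * `|x - y|;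
  f_monotone : forall t : R, 0 <= t <= T -> monotone_cost (f t) }.

Definition separable_monotone (ell : R -> 'cV[R]_r -> D -> prob R (r + s) -> R)
    (g : D -> prob R (r + s) -> R) : Prop :=
  exists (ell0 : R -> 'cV[R]_r -> D -> R) (f : R -> D -> prob R (r + s) -> R),
    [/\ forall (t : R) (a : 'cV[R]_r) (x : D) mu, 0 <= t <= T -> in_P1 mu ->
          ell t a x mu = ell0 t a x + f t x mu,
        separable_running_cost_hyp ell0, coupling_cost_hyp f & monotone_cost g].

End Data.

Section ControlBound.
Context {R : realType}.
Variables (T : R) (r s : nat).

Let D := 'cV[R]_(r + s).

Variables (A : R -> D -> D) (B : R -> D -> 'M[R]_(r + s, r)).
Variables (ell : R -> 'cV[R]_r -> D -> prob R (r + s) -> R).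
Variables (g : D -> prob R (r + s) -> R).

Definition dt (Nt : nat) : R := T / Nt%:R.

Definition tk (Nt k : nat) : R := k%:R * dt Nt.

(* m in C([0, T]; P_1(R^d)) *)
Definition flow (m : R -> prob R (r + s)) : Prop :=
  (forall t : R, 0 <= t <= T -> in_P1 (m t)) /\
  forall t : R, 0 <= t <= T -> forall e : R, 0 < e -> exists2 del : R, 0 < del &
    forall t' : R, 0 <= t' <= T -> `|t' - t| < del ->
      (d1 (m t') (m t) < e%:E)%E.

(* [traj Nt k x al n] is gamma_(k+n) *)
Fixpoint traj (Nt k : nat) (x : D) (al : nat -> 'cV[R]_r) (n : nat) : D :=
  if n is n'.+1 then
    let y := traj Nt k x al n' in let t := tk Nt (k + n') in
    y + dt Nt *: (A t y + B t y *m al (k + n')%N)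
  else x.

(* Only the values al j with k <= j < Nt matter. *)
Definition Jcost (Nt : nat) (m : R -> prob R (r + s)) (k : nat) (x : D)
    (al : nat -> 'cV[R]_r) : R :=
  dt Nt * (\sum_(k <= j < Nt)
             ell (tk Nt j) (al j) (traj Nt k x al (j - k)) (m (tk Nt j)))
  + g (traj Nt k x al (Nt - k)) (m T).

Definition control_bound (Chat : R) : Prop :=
  0 < Chat /\
  forall (Nt : nat) m k x al, (k < Nt)%N -> flow m ->
    (forall al', Jcost Nt m k x al <= Jcost Nt m k x al') ->
    forall j, (k <= j < Nt)%N -> `|al j| <= Chat.

End ControlBound.

Section Grid.
Context {R : realType}.

Definition dx (Ns : nat) : R := Ns%:R^-1.

Definition grid (n Ns : nat) : set 'cV[R]_n :=
  [set x | forall i, exists z : int, x i 0 = z%:~R * dx Ns].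

Definition fsupp n (phi : 'cV[R]_n -> R) : set 'cV[R]_n :=
  closure [set y | phi y != 0].

(* The element of the cartesian mesh with lowest vertex z. *)
Definition mesh_element n (Ns : nat) (z : 'cV[R]_n) : set 'cV[R]_n :=
  [set y | forall i, z i 0 <= y i 0 <= z i 0 + dx Ns].

Record Q1_basis n (Ns : nat) (CI : R) (beta : 'cV[R]_n -> 'cV[R]_n -> R)
    : Prop := {
  beta_ge0 : forall x y, grid Ns x -> 0 <= beta x y;
  beta_Q1 : forall x z, grid Ns x -> grid Ns z ->
    exists c : {set 'I_n} -> R, forall y, mesh_element Ns z y ->
      beta x y = \sum_(I : {set 'I_n}) c I * \prod_(i in I) y i 0;
  beta_diag : forall x, grid Ns x -> beta x x = 1;
  beta_offdiag : forall x x', grid Ns x -> grid Ns x' -> x' <> x ->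
    beta x x' = 0;
  beta_sum1 : forall y, \sum_(x \in grid Ns) beta x y = 1;
  beta_supp : forall x, grid Ns x ->
    fsupp (beta x) `<=` [set y | `|y - x| <= CI * dx Ns] }.

Definition interp n (beta : 'cV[R]_n -> 'cV[R]_n -> R) (F : set 'cV[R]_n)
    (phi : 'cV[R]_n -> R) (y : 'cV[R]_n) : R :=
  \sum_(x \in F) beta x y * phi x.

Definition cell n (Ns : nat) (x : 'cV[R]_n) : set 'cV[R]_n :=
  [set y | `|x - y| <= dx Ns / 2].

Definition entropy n (F : set 'cV[R]_n) (q : 'cV[R]_n -> R) : R :=
  \sum_(x \in F) q x * ln (q x).

End Grid.

Section Scheme.
Context {R : realType}.
Variables (T : R) (r s : nat).

Let D := 'cV[R]_(r + s).

Variables (A : R -> D -> D) (B : R -> D -> 'M[R]_(r + s, r)).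
Variables (ell : R -> 'cV[R]_r -> D -> prob R (r + s) -> R).
Variables (g : D -> prob R (r + s) -> R) (m0 : prob R (r + s)).
Variables (LA CB CI Chat eps : R).
Variable beta : nat -> 'cV[R]_s -> 'cV[R]_s -> R.
Variables (Nt Ns : nat).

Local Notation dt := (dt T Nt).
Local Notation dx := (dx Ns).
Local Notation t_ := (tk T Nt).
Local Notation b_ := (beta Ns).

Definition CA : R :=
  Num.max (sup [set `|A t 0| | t in [set t | 0 <= t <= T]]) LA.

Fixpoint Kset (k : nat) : set D :=
  if k is k'.+1 then
    let rho := dt * (CA * (1 + sup [set `|x| | x in Kset k']) + CB * Chat)
               + CI * dx in
    [set y + rho *: z | y in Kset k' & z in [set z : D | `|z| <= 1]]
  else msupp m0.

Definition alpha (k : nat) (x : D) (y1 : 'cV[R]_r) : 'cV[R]_r :=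
  invmx (usubmx (B (t_ k) x))
    *m (dt^-1 *: (y1 - usubmx x) - usubmx (A (t_ k) x)).

Definition yy2 (k : nat) (x : D) (y1 : 'cV[R]_r) : 'cV[R]_s :=
  dsubmx x
    + dt *: (dsubmx (A (t_ k) x) + dsubmx (B (t_ k) x) *m alpha k x y1).

(* S^1_(k+1)(x), S^2_(k+1)(x,y_1) and S_(k+1)(x) *)
Definition S1 (k : nat) (x : D) : set 'cV[R]_r :=
  [set y1 | grid Ns y1 /\ `|alpha k x y1| <= Chat].

Definition S2 (k : nat) (x : D) (y1 : 'cV[R]_r) : set 'cV[R]_s :=
  [set y2 | grid Ns y2 /\ fsupp (b_ y2) (yy2 k x y1)].

Definition Snext (k : nat) (x : D) : set D :=
  [set y | S1 k x (usubmx y) /\ S2 k x (usubmx y) (dsubmx y)].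

Fixpoint S_ (k : nat) : set D :=
  if k is k'.+1 then \bigcup_(x in S_ k') Snext k' x
  else grid Ns `&` Kset 0.

(* Elements of the product of the P(S_k), k = 0, ..., Nt, as families of
   weights. *)
Definition MM : set ('I_Nt.+1 -> D -> R) :=
  [set M | forall k : 'I_Nt.+1, in_P (S_ k) (M k)].

Section BestResponse.
Variable M : 'I_Nt.+1 -> D -> R.

Definition Mmeas (k : nat) : prob R (r + s) := measure_of (M (inord k)).

(* The functional of q in the definition of V_k(x), with W in place of
   V_(k+1). *)
Definition stage_cost (k : nat) (W : D -> R) (x : D) (q : 'cV[R]_r -> R) : R :=
  \sum_(y1 \in S1 k x) q y1 *
     (dt * ell (t_ k) (alpha k x y1) x (Mmeas k)
      + interp b_ (S2 k x y1) (fun y2 => W (col_mx y1 y2)) (yy2 k x y1))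
  + eps * entropy (S1 k x) q.

(* V_(Nt - n) *)
Fixpoint Vback (n : nat) : D -> R :=
  if n is n'.+1 then
    fun x => inf [set stage_cost (Nt - n) (Vback n') x q
                 | q in in_P (S1 (Nt - n) x)]
  else fun x => g x (Mmeas Nt).

Definition V (k : nat) : D -> R := Vback (Nt - k).

Definition pM (k : nat) (x : D) : 'cV[R]_r -> R :=
  get [set q | in_P (S1 k x) q /\ forall q', in_P (S1 k x) q' ->
        stage_cost k (V k.+1) x q <= stage_cost k (V k.+1) x q'].

Definition PM (k : nat) (x y : D) : R :=
  if y \in Snext k x then
    pM k x (usubmx y) * b_ (dsubmx y) (yy2 k x (usubmx y))
  else 0.

Definition Mhat0 (x : D) : R := if x \in S_ 0 then fine (m0 (cell Ns x)) else 0.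

Fixpoint Mhat (k : nat) : D -> R :=
  if k is k'.+1 then fun y => \sum_(x \in S_ k') PM k' x y * Mhat k' x
  else Mhat0.

Definition br : 'I_Nt.+1 -> D -> R := fun k => Mhat k.

End BestResponse.

Definition admissible_parameters (cK : R) : Prop :=
  [/\ (0 < Nt)%N, (0 < Ns)%N, dx / dt <= Num.min 1 (Chat / cK)
    & forall x : D, grid Ns x ->
        m0 (closure (cell Ns x) `\` interior (cell Ns x)) = 0%E].

End Scheme.

Arguments MM {R} T {r s} A B m0 LA CB CI Chat beta Nt Ns _.
Arguments br {R} T {r s} A B ell g m0 LA CB CI Chat eps beta Nt Ns M _ _.

(* Main.v *)
From HB Require Import structures.
From mathcomp Require Import all_boot all_order all_algebra finmap.
From mathcomp Require Import all_classical all_reals all_analysis measurable_realfun.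
From mathcomp Require Import ring lra zify.
Require Import Defs.

Set Implicit Arguments.
Unset Strict Implicit.
Unset Printing Implicit Defensive.

Import Order.TTheory GRing.Theory Num.Theory.
Import numFieldNormedType.Exports.

Local Open Scope classical_set_scope.
Local Open Scope ring_scope.

(** With M frozen, Bellman's equation shows that an occupation measure w costs
    the optimal value plus eps times the relative entropy of w with respect to
    the Gibbs policy of M; hence w is optimal if and only if its marginals are
    br(M). The fixed points of br are therefore the marginals of the solutions
    of a variational inequality on the compact convex set of occupation
    measures. The couplings f and g make it monotone, which gives uniqueness.

    Monotonicity also replaces Brouwer's theorem in the proof of existence. By
    a minimax argument for symmetric games, every finite subfamily of Minty's
    inequalities has a solution, hence by compactness so does the whole family;
    since d_1 is continuous along segments, a solution of Minty's inequalities
    solves the variational inequality. *)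

(** * Symmetric games *)

Section Simplex.
Context {R : realType}.

(** The unknown is an occupation measure rather than a policy because the law of the state is affine
    in the former, while in the latter it is a product over all earlier times. The total cost then
    splits into a linear part and a conditional entropy that is jointly convex in [w] and its
    marginals. Separability acts at one point: when two occupation measures are compared against two
    crowds, the control costs cancel and exactly the monotonicity sums of [f] and [g] remain. These
    are only nonnegative; the strictness behind uniqueness comes from the entropy. In Minty's form
    the crowd is the test measure, so the candidate appears only where the cost is continuous and
    convex, and compactness applies before continuity in the crowd is invoked. The grid contributes
    finiteness of the reachable sets, a nonnegative partition of unity and an admissible action at
    every reachable state. *)

Definition simplex (J : finType) (mu : J -> R) :=
  (forall j, 0 <= mu j) /\ \sum_j mu j = 1.

Lemma simplex_le1 (J : finType) (mu : J -> R) j : simplex mu -> mu j <= 1.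
Proof.
by move=> [m0 <-]; rewrite (bigD1 j)//= lerDl sumr_ge0.
Qed.

(* A named copy, because [compact_In0] needs a pointed topological type. *)
Definition fspace (I : eqType) : Type :=
  prod_topology (fun _ : I => R : topologicalType).
HB.instance Definition _ (I : eqType) := Topological.copy (fspace I)
  (prod_topology (fun _ : I => R : topologicalType)).
HB.instance Definition _ (I : eqType) := isPointed.Build (fspace I) (fun=> 0).

Lemma eval_continuous (I : eqType) (i : I) :
  continuous (fun f : fspace I => f i).
Proof. exact: (@proj_continuous I (fun=> R)). Qed.

Lemma sum_continuous (T : topologicalType) (J : Type) (s : seq J) (P : pred J)
    (F : J -> T -> R) :
  (forall j, continuous (F j)) -> continuous (fun f => \sum_(j <- s | P j) F j f).
Proof.
move=> cF f; elim: s => [|j s IH].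
  by under eq_fun do rewrite big_nil; exact: cvg_cst.
under eq_fun do rewrite big_cons.
by case: (P j) => //; apply: cvgD => //; exact: cF.
Qed.

Lemma const_continuous (T : topologicalType) (a : R) :
  continuous (fun _ : T => a).
Proof. exact: (@cst_continuous T R a). Qed.

Lemma add_continuous (T : topologicalType) (F G : T -> R) :
  continuous F -> continuous G -> continuous (fun f => F f + G f).
Proof. by move=> cF cG f; apply: cvgD; [exact: cF | exact: cG]. Qed.

Lemma mulrl_continuous (T : topologicalType) (F : T -> R) (a : R) :
  continuous F -> continuous (fun f => a * F f).
Proof. by move=> cF f; apply: cvgM; [exact: cvg_cst | exact: cF]. Qed.

Lemma mulrr_continuous (T : topologicalType) (F : T -> R) (a : R) :
  continuous F -> continuous (fun f => F f * a).
Proof. by move=> cF f; apply: cvgM; [exact: cF | exact: cvg_cst]. Qed.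

Lemma closed_preimage (T : topologicalType) (F : T -> R) (A : set R) :
  continuous F -> closed A -> closed (F @^-1` A).
Proof. by move=> /continuous_closedP; apply. Qed.

Lemma simplex_compact (J : finType) :
  compact ([set mu | simplex mu] : set (fspace J)).
Proof.
apply: (@subclosed_compact _ _ [set f : fspace J | forall i, `[0 : R, 1]%classic (f i)]).
- rewrite (_ : [set _ | _] =
     (\bigcap_j ((fun f : fspace J => f j) @^-1` [set x | 0 <= x]))
     `&` ((fun f : fspace J => \sum_j f j) @^-1` [set x | x = 1])).
    apply: closedI; last first.
      apply: closed_preimage; last exact: closed_eq.
      by apply: sum_continuous => j; exact: eval_continuous.
    apply: closed_bigI => j _; apply: closed_preimage; last exact: closed_ge.
    exact: eval_continuous.
  by apply/seteqP; split=> f [H1 H2]; split=> // j; [move=> _ | ]; exact: H1.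
- by apply: (@tychonoff J (fun=> R) (fun=> `[0, 1]%classic)) => j; exact: segment_compact.
- move=> f sf j /=; rewrite in_itv/= (simplex_le1 _ sf) andbT.
  by case: sf.
Qed.

(* A minimiser mu of sum_i ((a mu)_i^+)^2 works: otherwise moving mu towards
   nu, proportional to (a mu)^+, would decrease the sum. *)
Lemma symmetric_game (J : finType) (j0 : J) (a : J -> J -> R) :
  (forall i j, a i j + a j i <= 0) ->
  exists2 mu : J -> R, simplex mu & forall i, \sum_j a i j * mu j <= 0.
Proof.
move=> aS.
pose b (mu : J -> R) i := \sum_j a i j * mu j.
pose pos (x : R) := Num.max 0 x.
pose phi (mu : J -> R) := \sum_i (pos (b mu i)) ^+ 2.
have posc : continuous pos.
  by move=> x; apply: (@continuous_max R R (cst 0) id); [exact: cvg_cst|exact: cvg_id].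
have cphi : continuous (phi : fspace J -> R).
  apply: sum_continuous => i f.
  have cb : continuous (fun f : fspace J => pos (b f i)).
    move=> g; apply: (@continuous_comp _ _ _ (fun f : fspace J => b f i) pos); last exact: posc.
    apply: sum_continuous => j; apply: mulrl_continuous; exact: eval_continuous.
  exact: (cvgM (cb f) (cb f)).
have [|mu mus mumin] := @compact_EVT_min (fspace J) R phi _ _
  (@simplex_compact J) (continuous_subspaceT cphi).
  exists (fun j => (j == j0)%:R); split; first by move=> j; exact: ler0n.
  by rewrite (bigD1 j0)//= eqxx big1 ?addr0// => j /negbTE ->.
rewrite inE /= in mus; exists mu => // i0; apply/negP => /negP; rewrite -ltNge => bi0.
pose lam i := pos (b mu i).
have lam0 i : 0 <= lam i by rewrite /lam /pos le_max lexx.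
have Lgt0 : 0 < \sum_i lam i.
  rewrite (bigD1 i0)//=; apply: ltr_pwDl; last exact: sumr_ge0.
  by rewrite /lam /pos lt_max; apply/orP; right.
set Lm := \sum_i lam i in Lgt0.
pose nu j := lam j / Lm.
have nus : simplex nu.
  split=> [j|]; first by rewrite divr_ge0// ltW.
  by rewrite -mulr_suml divff// gt_eqF.
pose d i := b nu i - b mu i.
pose P := \sum_i lam i ^+ 2.
pose Q := \sum_i d i ^+ 2.
have P0 : 0 < P.
  rewrite /P (bigD1 i0)//=; apply: ltr_pwDl; last by apply: sumr_ge0 => i _; exact: sqr_ge0.
  by rewrite exprn_gt0// /lam /pos lt_max; apply/orP; right.
have Q0 : 0 <= Q by apply: sumr_ge0 => i _; exact: sqr_ge0.
(* Up to a factor 2, this is the slope of [phi] from [mu] towards [nu]: [lam] paired with [b mu]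
   gives [P], and paired with [b nu], a multiple of [a lam], gives at most 0 by the sign condition
   on [a]. *)
have lamd : \sum_i lam i * d i <= - P.
  rewrite /d; under eq_bigr do rewrite mulrBr; rewrite sumrB.
  have -> : \sum_i lam i * b mu i = P.
    apply: eq_bigr => i _; rewrite expr2 /lam /pos.
    by case: (leP 0 (b mu i)) => h; rewrite ?mul0r.
  rewrite gerDr.
  have -> : \sum_i lam i * b nu i = (\sum_i \sum_j lam i * lam j * a i j) / Lm.
    rewrite mulr_suml; apply: eq_bigr => i _.
    rewrite /b mulr_sumr mulr_suml; apply: eq_bigr => j _.
    by rewrite /nu; ring.
  apply: mulr_le0_ge0; last by rewrite invr_ge0 ltW.
  have S2 : (\sum_i \sum_j lam i * lam j * a i j) *+ 2 =
     \sum_i \sum_j lam i * lam j * (a i j + a j i).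
    rewrite mulr2n {2}exchange_big -big_split /=; apply: eq_bigr => i _.
    by rewrite -big_split /=; apply: eq_bigr => j _; ring.
  suff : (\sum_i \sum_j lam i * lam j * a i j) *+ 2 <= 0 by rewrite mulr2n; lra.
  rewrite S2.
  apply: sumr_le0 => i _; apply: sumr_le0 => j _.
  by apply: mulr_ge0_le0 => //; exact: mulr_ge0.
(* Since [t * Q <= P], the value at [mt] is at most [P - 2 t P + t (t Q) <= P - t P], below the
   minimum [P]; [Q + 1] avoids a division by zero. *)
pose t := Num.min 1 (P / (Q + 1)).
have t0 : 0 < t by rewrite /t lt_min ltr01 divr_gt0// ltr_wpDl.
have t1 : t <= 1 by rewrite /t ge_min lexx.
have tQ : t * Q <= P.
  apply: (@le_trans _ _ (P / (Q + 1) * Q)).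
    by apply: ler_wpM2r => //; rewrite /t ge_min lexx orbT.
  rewrite -mulrA; apply: ler_piMr; first exact: ltW.
  rewrite mulrC ler_pdivrMr ?ltr_wpDl//; lra.
pose mt j := (1 - t) * mu j + t * nu j.
have mts : simplex mt.
  split=> [j|].
    by apply: addr_ge0; apply: mulr_ge0; [lra | case: mus| exact: ltW | case: nus].
  rewrite big_split /= -!mulr_sumr; case: mus => _ ->; case: nus => _ ->; ring.
have := mumin mt; rewrite inE => /(_ mts); apply/negP; rewrite -ltNge.
have bmt i : b mt i = b mu i + t * d i.
  rewrite /d /b mulrBr !mulr_sumr -sumrB -big_split /=; apply: eq_bigr => j _.
  by rewrite /mt; ring.
apply: (@le_lt_trans _ _ (\sum_i (lam i + t * d i) ^+ 2)).
  apply: ler_sum => i _; rewrite bmt.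
  have : b mu i <= lam i by rewrite /lam /pos le_max lexx orbT.
  move: (lam i) => l hl; rewrite /pos; case: (leP 0 (b mu i + t * d i)) => h.
    by apply: lerXn2r; rewrite ?nnegrE; lra.
  by rewrite expr0n/= sqr_ge0.
have -> : \sum_i (lam i + t * d i) ^+ 2 = P + 2 * t * (\sum_i lam i * d i) + t * (t * Q).
  rewrite /P /Q !mulr_sumr -!big_split /=; apply: eq_bigr => i _; ring.
rewrite -/P (_ : phi mu = P)//.
have := ler_wpM2l (ltW t0) tQ; have := ler_wpM2l (ltW t0) lamd; have := mulr_gt0 t0 P0; lra.
Qed.

End Simplex.
(** * Minty's variational inequality *)

Section Minty.
Context {R : realType} (I : choiceType).
Local Notation E := (@fspace R I).

Definition cvxcomb (J : finType) (mu : J -> R) (u : J -> I -> R) : I -> R :=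
  fun i => \sum_j mu j * u j i.

Definition segment (t : R) (u v : I -> R) : I -> R :=
  fun i => (1 - t) * u i + t * v i.

Lemma segment_cvxcomb t (u v : I -> R) :
  segment t u v = cvxcomb (fun b : bool => if b then t else 1 - t)
                          (fun b => if b then v else u).
Proof. by apply/funext => i; rewrite /cvxcomb big_bool /segment addrC. Qed.

Lemma simplex_bool (t : R) : 0 <= t <= 1 ->
  simplex (fun b : bool => if b then t else 1 - t).
Proof.
move=> /andP[t0 t1]; split; last by rewrite big_bool/= addrC subrK.
by case => //; rewrite subr_ge0.
Qed.

Variables (K : set E) (L : (I -> R) -> (I -> R) -> R) (H : (I -> R) -> R).
Hypothesis K0 : K !=set0.
Hypothesis Kcompact : compact K.
Hypothesis Kconvex : forall (J : finType) (mu : J -> R) (u : J -> I -> R),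
  simplex mu -> (forall j, K (u j)) -> K (cvxcomb mu u).
Hypothesis Laffine : forall (J : finType) (mu : J -> R) (u : J -> I -> R) w,
  simplex mu -> (forall j, K (u j)) -> K w ->
  L w (cvxcomb mu u) = \sum_j mu j * L w (u j).
Hypothesis Hconvex : forall (J : finType) (mu : J -> R) (u : J -> I -> R),
  simplex mu -> (forall j, K (u j)) ->
  H (cvxcomb mu u) <= \sum_j mu j * H (u j).
Hypothesis Lcont : forall w, K w -> continuous (L w : E -> R).
Hypothesis Hcont : continuous (H : E -> R).
Hypothesis Lmonotone : forall u v, K u -> K v ->
  L u v - L u u + (L v u - L v v) <= 0.
Hypothesis Lhemicont : forall u v w, K u -> K v -> K w ->
  L (segment t u v) w @[t --> 0^'+] --> L u w.

(** The excess cost of [v] over [u] when the crowd is frozen at [u]. In [Psi u v + Psi v u] the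
    terms in [H] cancel, so [Lmonotone] makes this sum nonpositive. *)
Let Psi u v := L u v - L u u + (H v - H u).

(** The matrix [Psi (u i) (u j)] meets the sign condition of [symmetric_game]; the resulting mixture
    is realised by a barycentre, because each [Psi (u i)] is convex. *)
Lemma minty_finite (J : finType) (u : J -> I -> R) : J -> (forall j, K (u j)) ->
  exists2 v, K v & forall j, Psi (u j) v <= 0.
Proof.
move=> j0 Ku.
have [i j|mu mus le0] := @symmetric_game R J j0 (fun i j => Psi (u i) (u j)).
  by have := Lmonotone (Ku i) (Ku j); rewrite /Psi; lra.
exists (cvxcomb mu u); first exact: Kconvex.
move=> i; apply: le_trans (le0 i); rewrite /Psi Laffine//.
have -> : \sum_j (L (u i) (u j) - L (u i) (u i) + (H (u j) - H (u i))) * mu j =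
    \sum_j mu j * L (u i) (u j) + \sum_j mu j * H (u j)
    - (\sum_j mu j) * (L (u i) (u i) + H (u i)).
  by rewrite mulr_suml -sumrN -!big_split /=; apply: eq_bigr => j _; ring.
by case: (mus) => _ ->; have := Hconvex mus Ku; lra.
Qed.

Lemma minty : exists2 u, K u & forall v, K v -> 0 <= Psi u v.
Proof.
have Kseg t u v : 0 <= t <= 1 -> K u -> K v -> K (segment t u v).
  move=> t01 Ku Kv; rewrite segment_cvxcomb; apply: Kconvex; first exact: simplex_bool.
  by case.
have cPsi w : K w -> continuous (Psi w : E -> R).
  move=> Kw.
  have cc a := @const_continuous R E a.
  exact (add_continuous (add_continuous (Lcont Kw) (cc (- L w w)))
                        (add_continuous Hcont (cc (- H w)))).
(* The unknown is now the second argument of [Psi], in which it is continuous: the solution sets are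
   closed in [K], and [minty_finite] gives them the finite intersection property. *)
have : exists2 u, K u & forall v, K v -> Psi v u <= 0.
  have cIn := Kcompact; rewrite compact_In0 in cIn.
  have [||u uK] := cIn {classic E} K (fun w => K `&` (Psi w : E -> R) @^-1` [set x | x <= 0]).
  - exists (fun w => (Psi w : E -> R) @^-1` [set x | x <= 0]) => // w Kw.
    exact (closed_preimage (cPsi _ Kw) (closed_le (y := 0))).
  - move=> D DK.
    have [->|[w0 w0D]] := fset_0Vmem D.
      by exists (fun=> 0) => w.
    have [|v Kv Hv] := minty_finite (u := fun d : D => val d) [` w0D]%fset.
      by move=> d; have := DK _ (valP d); rewrite inE.
    by exists v => w /= wD; split=> //; exact: (Hv [` wD]%fset).
  have [w Kw] := K0.
  exists u; first by have [] := uK w Kw.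
  by move=> v Kv; have [] := uK v Kv.
move=> [u Ku Hu]; exists u => // v Kv.
rewrite leNgt; apply/negP => neg.
(* Half of the assumed violation: the two limits below, for [v] and for [u], each cost less than
   [e]. *)
set e := - Psi u v / 2; have e0 : 0 < e by rewrite /e; lra.
have /cvgrPdist_lt/(_ _ e0) near1 := Lhemicont Ku Kv Kv.
have /cvgrPdist_lt/(_ _ e0) near2 := Lhemicont Ku Kv Ku.
have near3 : \forall t \near (0 : R)^'+, 0 < t <= 1.
  near=> t; apply/andP; split; first by near: t; exact: nbhs_right_gt.
  by near: t; exact: nbhs_right_le.
have : \forall t \near (0 : R)^'+, [/\ `|L u v - L (segment t u v) v| < e,
    `|L u u - L (segment t u v) u| < e & 0 < t <= 1].
  by near=> t; split; near: t.
move=> /(@filter_ex _ _ (at_right_proper_filter 0))[t [near1t near2t /andP[t0 t1]]].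
have t01 : 0 <= t <= 1 by rewrite ltW.
have Kt := Kseg _ _ _ t01 Ku Kv.
have := Hu _ Kt; rewrite /Psi.
have Lt : L (segment t u v) (segment t u v) =
    (1 - t) * L (segment t u v) u + t * L (segment t u v) v.
  rewrite {2}segment_cvxcomb Laffine//; last by case.
    by rewrite big_bool /= addrC.
  exact: simplex_bool.
have Ht : H (segment t u v) <= (1 - t) * H u + t * H v.
  rewrite segment_cvxcomb; apply: le_trans (Hconvex _ _) _; first exact: simplex_bool.
    by case.
  by rewrite big_bool /= addrC.
rewrite Lt.
move: near1t near2t; rewrite !ltr_distl => /andP[h1 h2] /andP[h3 h4].
move: Ht h1 h2 h3 h4 neg; rewrite /e /Psi.
move: (L _ u) (L _ v) (L u v) (L u u) (H u) (H v) (H _) => a b c d x y z Ht h1 h2 h3 h4 neg.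
move=> le.
(* Minty's inequality at a point of the segment: since [L] is affine and [H] convex, the
   contributions of weight [1 - t] cancel and a factor [t] can be divided out. *)
have : t * (a - b + (x - y)) <= 0 by lra.
rewrite pmulr_rle0//; lra.
Unshelve. all: by end_near. Qed.

End Minty.
(** * Relative entropy *)

Section Entropy.
Context {R : realType}.
Implicit Types w m v z : R.

Lemma ge0_neq_gt0 w : 0 <= w -> w != 0 -> 0 < w.
Proof. by move=> w0 wn; rewrite lt_neqAle eq_sym wn. Qed.

(** This is [ln x <= x - 1] at [x = v / w]. The terms [w - v] cancel when summed over weights of
    equal mass. *)
Lemma kl_ge w v : 0 <= w -> 0 < v -> w - v <= w * (ln w - ln v).
Proof.
move=> w0 v0; have [->|wn] := eqVneq w 0; first by rewrite mul0r; lra.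
have {wn}w0 : 0 < w by exact: ge0_neq_gt0.
have h : 0 < v / w by exact: divr_gt0.
have := @le_ln1Dx R (v / w - 1); rewrite ltrBrDl subrr => /(_ h).
rewrite addrC subrK ln_div ?posrE// => le.
have := ler_wpM2l (ltW w0) le.
have -> : w * (v / w - 1) = v - w by rewrite mulrBr mulr1 mulrCA divff ?gt_eqF// mulr1.
lra.
Qed.

Lemma kl_eq w v : 0 <= w -> 0 < v -> w * (ln w - ln v) <= w - v -> w = v.
Proof.
move=> w0 v0; have [->|wn] := eqVneq w 0; first by rewrite mul0r; lra.
have {wn}w0 : 0 < w by exact: ge0_neq_gt0.
move=> le; have vw : v / w = 1; last by rewrite -[w]mul1r -vw divfK ?gt_eqF.
have h : 0 < v / w by exact: divr_gt0.
(* [ln x >= x - 1] forces [x = 1]: compare with [2 ln (sqrt x) <= 2 (sqrt x - 1)]. *)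
set x := v / w in h *.
have lx : x - 1 <= ln x.
  rewrite /x ln_div ?posrE// -(ler_pM2l w0).
  have -> : w * (v / w - 1) = v - w by rewrite mulrBr mulr1 mulrCA divff ?gt_eqF// mulr1.
  lra.
have sx : Num.sqrt x ^+ 2 = x by rewrite sqr_sqrtr// ltW.
have s0 : 0 < Num.sqrt x by rewrite sqrtr_gt0.
have ls := @le_ln1Dx R (Num.sqrt x - 1).
rewrite ltrBrDl subrr addrC subrK in ls; have {}ls := ls s0.
have lnx : ln x = 2 * ln (Num.sqrt x) by rewrite -{1}sx lnXn// mulr_natl.
have : (Num.sqrt x - 1) ^+ 2 <= 0.
  have -> : (Num.sqrt x - 1) ^+ 2 = x - 2 * Num.sqrt x + 1 by rewrite -{2}sx; ring.
  lra.
by rewrite real_exprn_even_le0 ?num_real//= subr_eq0 -{2}sx => /eqP ->; rewrite expr1n.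
Qed.

(** The right-hand side is convex and homogeneous of degree one in [w] and [m]; the left-hand side
    is its tangent plane along the ray [w = m z]. The bound [w <= m] settles the case [m = 0]. *)
Lemma relent_tangent w m z : 0 <= w <= m -> 0 < z ->
  w * ln z + w - m * z <= w * (ln w - ln m).
Proof.
move=> /andP[w0 wm] z0; have [mE|mn] := eqVneq m 0.
  have -> : w = 0 by apply/eqP; rewrite eq_le w0 -mE wm.
  by rewrite mE !mul0r; lra.
have m0 : 0 < m by apply: ge0_neq_gt0 => //; exact: le_trans wm.
have := kl_ge w0 (mulr_gt0 m0 z0); rewrite lnM ?posrE//; lra.
Qed.

Lemma relent_tangent_eq w m z : 0 <= w <= m -> 0 < z ->
  w * (ln w - ln m) <= w * ln z + w - m * z -> w = m * z.
Proof.
move=> /andP[w0 wm] z0; have [mE|mn] := eqVneq m 0.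
  by move=> _; apply/eqP; rewrite mE mul0r eq_le w0 -mE wm.
have m0 : 0 < m by apply: ge0_neq_gt0 => //; exact: le_trans wm.
move=> h; apply: (kl_eq w0 (mulr_gt0 m0 z0)); rewrite lnM ?posrE//; lra.
Qed.

(** Each term lies above the tangent plane along the ray through the barycentre of the pairs, and
    the average of that plane is its value at the barycentre, where it touches. *)
Lemma relent_convex (J : finType) (mu w m : J -> R) : simplex mu ->
  (forall j, 0 <= w j <= m j) ->
  let W := \sum_j mu j * w j in let M := \sum_j mu j * m j in
  W * (ln W - ln M) <= \sum_j mu j * (w j * (ln (w j) - ln (m j))).
Proof.
move=> [mu0 _] wm; set W := \sum_j mu j * w j; set M := \sum_j mu j * m j => /=.
have W0 : 0 <= W by apply: sumr_ge0 => j _; case/andP: (wm j) => *; exact: mulr_ge0.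
have WM : W <= M by apply: ler_sum => j _; case/andP: (wm j) => *; exact: ler_wpM2l.
have [WE|Wn] := eqVneq W 0.
  rewrite WE mul0r; apply: sumr_ge0 => j _.
  have : mu j * w j = 0.
    apply/eqP; move/eqP: WE; rewrite psumr_eq0; first by move/allP/(_ j); apply; rewrite mem_index_enum.
    by move=> i _; case/andP: (wm i) => *; exact: mulr_ge0.
  by rewrite mulrA => ->; rewrite mul0r.
have {Wn}W0 : 0 < W by exact: ge0_neq_gt0.
have M0 : 0 < M by exact: lt_le_trans WM.
have z0 : 0 < W / M by exact: divr_gt0.
apply: (@le_trans _ _ (\sum_j mu j * (w j * ln (W / M) + w j - m j * (W / M)))); last first.
  by apply: ler_sum => j _; apply: ler_wpM2l => //; exact: relent_tangent.
have -> : \sum_j mu j * (w j * ln (W / M) + w j - m j * (W / M)) =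
    W * ln (W / M) + W - M * (W / M).
  rewrite /W [in RHS]/M !mulr_suml -sumrN -!big_split /=; apply: eq_bigr => j _; ring.
by rewrite (mulrC M) divfK ?gt_eqF// addrK ln_div ?posrE.
Qed.

(** [ln] is 0 on the nonpositive reals, hence discontinuous at 0; the product is continuous on the
    whole line. *)
Definition xlnx w := w * ln w.

Lemma xlnx_continuous : continuous xlnx.
Proof.
move=> x; have [x0|x0|<-] := ltgtP 0 x.
- by apply: cvgM; [exact: cvg_id | exact: continuous_ln].
- rewrite /continuous_at /xlnx (ln0 (ltW x0)) mulr0.
  apply: (@cvg_trans _ (cst (0 : R) @ x)); last exact: (@cst_continuous R R 0).
  apply: near_eq_cvg; near=> y; rewrite /= ln0 ?mulr0//.
  by near: y; exact: lt_le_nbhsl.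
have xlnx0 : xlnx 0 = 0 by rewrite /xlnx mul0r.
apply/cvgrPdist_lt => e e0; near=> y; rewrite xlnx0 sub0r normrN /xlnx.
have [y0|y0] := leP y 0; first by rewrite ln0// mulr0 normr0.
have y1 : y < 1 by near: y; exact: lt_nbhsl.
have s0 : 0 < Num.sqrt y by rewrite sqrtr_gt0.
have yE : y = Num.sqrt y ^+ 2 by rewrite sqr_sqrtr// ltW.
have ln_neg : ln y <= 0 by rewrite ln_le0// ltW.
rewrite ler0_norm; last by rewrite mulr_ge0_le0// ltW.
(* [ln z < z] at [z = 1 / sqrt y] bounds [- y ln y] by [2 sqrt y]. *)
have ls := ln_sublinear (divr_gt0 (@ltr01 R) s0).
rewrite div1r lnV ?posrE// in ls.
have : - (y * ln y) <= 2 * Num.sqrt y.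
  rewrite {2}yE lnXn// mulr2n {1}yE expr2.
  have := ler_wpM2l (ltW (mulr_gt0 s0 s0)) (ltW ls).
  rewrite -[leRHS]mulrA divff ?gt_eqF//; lra.
move/le_lt_trans; apply; rewrite -ltr_pdivlMl//.
rewrite -(ltr_pXn2r (n := 2))// ?nnegrE ?sqrtr_ge0 ?mulr_ge0 ?ltW//.
rewrite sqr_sqrtr ?ltW//; near: y; apply: lt_nbhsl.
by rewrite exprn_gt0// mulr_gt0.
Unshelve. all: by end_near. Qed.

End Entropy.
Lemma sum_eq0_ge0_seq (R : realType) (I : eqType) (s : seq I) (f : I -> R) :
  {in s, forall i, 0 <= f i} -> \sum_(i <- s) f i <= 0 -> {in s, forall i, f i = 0}.
Proof.
elim: s => [//|j s IH] f0; rewrite big_cons => le0.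
have fj : 0 <= f j by apply: f0; rewrite mem_head.
have fs : {in s, forall i, 0 <= f i} by move=> i si; apply: f0; rewrite in_cons si orbT.
have S0 : 0 <= \sum_(i <- s) f i by rewrite big_seq; apply: sumr_ge0 => i; exact: fs.
move=> i; rewrite in_cons => /orP[/eqP -> | si]; first by apply/eqP; rewrite eq_le fj andbT; lra.
by apply: IH => //; lra.
Qed.

(** * The Gibbs variational principle on a finite set *)

Section SoftMin.
Context {R : realType} (Y : choiceType) (eps : R).
Hypothesis eps_gt0 : 0 < eps.
Implicit Types (h : Y -> R) (A : seq Y).

Definition softmin h A := - eps * ln (\sum_(a <- A) expR (- h a / eps)).

(** The Gibbs weights [exp (- h / eps) / Z]; with [Z] expressed through [softmin], [h] plus [eps]
    times the logarithm of the weight is constant on [A]. *)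
Definition softargmin h A a :=
  if a \in A then expR ((softmin h A - h a) / eps) else 0.

Lemma softargmin_ge0 h A a : 0 <= softargmin h A a.
Proof. by rewrite /softargmin; case: ifP => // _; exact: expR_ge0. Qed.

Lemma softargmin_gt0 h A a : a \in A -> 0 < softargmin h A a.
Proof. by rewrite /softargmin => ->; exact: expR_gt0. Qed.

Lemma softargmin_out h A a : a \notin A -> softargmin h A a = 0.
Proof. by rewrite /softargmin => /negbTE ->. Qed.

Lemma softargmin_eq h A a : a \in A ->
  h a + eps * ln (softargmin h A a) = softmin h A.
Proof.
move=> aA; rewrite /softargmin aA expRK mulrC divfK ?gt_eqF//; ring.
Qed.

Lemma softargmin_sum h A : A != [::] -> \sum_(a <- A) softargmin h A a = 1.
Proof.
move=> A0; set Z := \sum_(a <- A) expR (- h a / eps).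
have Z0 : 0 < Z.
  case: A A0 @Z => [//|a A] _; rewrite big_cons.
  by apply: ltr_pwDl; [exact: expR_gt0 | apply: sumr_ge0 => ? _; exact: expR_ge0].
have -> : \sum_(a <- A) softargmin h A a = \sum_(a <- A) expR (- h a / eps) / Z.
  apply: eq_big_seq => a aA; rewrite /softargmin aA /softmin -/Z.
  have -> : (- eps * ln Z - h a) / eps = - h a / eps - ln Z.
    by field; rewrite gt_eqF.
  by rewrite expRD expRN lnK.
by rewrite -mulr_suml divff// gt_eqF.
Qed.

Lemma softmin_ext h h' A : {in A, h =1 h'} -> softmin h A = softmin h' A.
Proof.
move=> hh'; congr (_ * ln _); apply: eq_big_seq => a aA; by rewrite hh'.
Qed.

Lemma softargmin_ext h h' A : {in A, h =1 h'} -> softargmin h A =1 softargmin h' A.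
Proof.
move=> hh' a; rewrite /softargmin; case: ifP => // aA.
by rewrite (softmin_ext hh') hh'.
Qed.

(** Substituting [h = softmin - eps ln softargmin] turns the excess over [softmin] into a relative
    entropy, which yields both the minimum and the uniqueness of the minimiser. *)
Lemma free_energy h A (q : Y -> R) : \sum_(a <- A) q a = 1 ->
  \sum_(a <- A) q a * h a + eps * \sum_(a <- A) q a * ln (q a) =
  softmin h A + eps * \sum_(a <- A) q a * (ln (q a) - ln (softargmin h A a)).
Proof.
move=> q1; rewrite -[softmin h A]mul1r -q1 mulr_suml !mulr_sumr -!big_split /=.
by apply: eq_big_seq => a aA; rewrite -(softargmin_eq h aA); ring.
Qed.

Lemma kl_sum_ge0 A (q pi : Y -> R) :
  (forall a, 0 <= q a) -> {in A, forall a, 0 < pi a} ->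
  \sum_(a <- A) q a = \sum_(a <- A) pi a ->
  0 <= \sum_(a <- A) q a * (ln (q a) - ln (pi a)).
Proof.
move=> q0 pi0 qpi.
apply: (@le_trans _ _ (\sum_(a <- A) (q a - pi a))); first by rewrite sumrB qpi subrr.
by rewrite [leLHS]big_seq [leRHS]big_seq; apply: ler_sum => a aA; apply: kl_ge => //; exact: pi0.
Qed.

Lemma kl_sum_eq0 A (q pi : Y -> R) :
  (forall a, 0 <= q a) -> {in A, forall a, 0 < pi a} ->
  \sum_(a <- A) q a = \sum_(a <- A) pi a ->
  \sum_(a <- A) q a * (ln (q a) - ln (pi a)) <= 0 -> {in A, q =1 pi}.
Proof.
move=> q0 pi0 qpi le0 a aA; apply: kl_eq; [exact: q0 | exact: pi0 |].
rewrite -subr_le0 -[leRHS](_ : q a * (ln (q a) - ln (pi a)) - (q a - pi a) = 0) //.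
apply: (@sum_eq0_ge0_seq R _ A (fun a => q a * (ln (q a) - ln (pi a)) - (q a - pi a))) => //.
  by move=> b bA; rewrite subr_ge0; apply: kl_ge => //; exact: pi0.
by rewrite !sumrB qpi subrr subr0.
Qed.

Lemma softmin_le h A (q : Y -> R) : A != [::] -> (forall a, 0 <= q a) ->
  \sum_(a <- A) q a = 1 ->
  softmin h A <= \sum_(a <- A) q a * h a + eps * \sum_(a <- A) q a * ln (q a).
Proof.
move=> A0 q0 q1; rewrite free_energy// lerDl mulr_ge0 ?(ltW eps_gt0)//.
by apply: kl_sum_ge0 => //; [move=> a; exact: softargmin_gt0 | rewrite softargmin_sum].
Qed.

Lemma softmin_unique h A (q : Y -> R) : A != [::] -> (forall a, 0 <= q a) ->
  \sum_(a <- A) q a = 1 ->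
  \sum_(a <- A) q a * h a + eps * \sum_(a <- A) q a * ln (q a) <= softmin h A ->
  {in A, q =1 softargmin h A}.
Proof.
move=> A0 q0 q1; rewrite free_energy// gerDl pmulr_rle0// => le0.
by apply: kl_sum_eq0 => //; [move=> a; exact: softargmin_gt0 | rewrite softargmin_sum].
Qed.

Lemma softmin_attained h A : A != [::] ->
  \sum_(a <- A) softargmin h A a * h a +
  eps * \sum_(a <- A) softargmin h A a * ln (softargmin h A a) = softmin h A.
Proof.
move=> A0; rewrite free_energy ?softargmin_sum//.
by rewrite [X in _ + eps * X]big1 ?mulr0 ?addr0// => a _; rewrite subrr mulr0.
Qed.

End SoftMin.

Lemma sum_cvg (R : realType) (T : Type) (F : set_system T) (J : eqType) (s : seq J)
    (f : J -> T -> R) (l : J -> R) : Filter F ->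
  {in s, forall j, f j x @[x --> F] --> l j} ->
  \sum_(j <- s) f j x @[x --> F] --> \sum_(j <- s) l j.
Proof.
move=> FF; elim: s => [|j s IH] fl.
  under eq_fun do rewrite big_nil; rewrite big_nil; exact: cvg_cst.
under eq_fun do rewrite big_cons; rewrite big_cons; apply: cvgD.
  by apply: fl; rewrite mem_head.
by apply: IH => i si; apply: fl; rewrite in_cons si orbT.
Qed.

(** * Finite mean field games *)

Definition weights {R : realType} (X : eqType) (s : seq X) (m : X -> R) :=
  [/\ forall x, 0 <= m x, forall x, x \notin s -> m x = 0
    & \sum_(x <- s) m x = 1].

Section FiniteMFG.
Context {R : realType} (X Y : choiceType) (N : nat).
Variables (S : nat -> seq X) (U : nat -> X -> seq Y).
Variables (Q : nat -> X -> Y -> X -> R) (m0 : X -> R).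
Variables (c : nat -> X -> Y -> R) (F : nat -> (X -> R) -> X -> R) (eps : R).

(** The separable structure: the action enters through [c] and [Q], the crowd through [F]. *)
Definition qvalue (M : nat -> X -> R) k (W : X -> R) x a :=
  c k x a + F k (M k) x + \sum_(y <- S k.+1) Q k x a y * W y.

(* Indexed by the remaining time: [value_back M n] lives at time N - n. *)
Fixpoint value_back (M : nat -> X -> R) n : X -> R :=
  if n is n'.+1 then
    fun x => softmin eps (qvalue M (N - n) (value_back M n') x) (U (N - n) x)
  else F N (M N).

Definition value M k := value_back M (N - k).

Definition policy M k x : Y -> R :=
  softargmin eps (qvalue M k (value M k.+1) x) (U k x).

Fixpoint dist (p : nat -> X -> Y -> R) k : X -> R :=
  if k is k'.+1 then
    fun y => \sum_(x <- S k') \sum_(a <- U k' x) dist p k' x * p k' x a * Q k' x a y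
  else m0.

Hypothesis eps_gt0 : 0 < eps.
Hypothesis U_neq0 : forall k x, (k < N)%N -> x \in S k -> U k x != [::].
Hypothesis Q_ge0 : forall k x a y, (k < N)%N -> x \in S k -> a \in U k x ->
  0 <= Q k x a y.
Hypothesis Q_sum : forall k x a, (k < N)%N -> x \in S k -> a \in U k x ->
  \sum_(y <- S k.+1) Q k x a y = 1.
Hypothesis Q_out : forall k x a y, (k < N)%N -> x \in S k -> a \in U k x ->
  y \notin S k.+1 -> Q k x a y = 0.
Hypothesis m0_weights : weights (S 0) m0.
Hypothesis F_monotone : forall k m m', (k <= N)%N -> weights (S k) m -> weights (S k) m' ->
  0 <= \sum_(x <- S k) (F k m x - F k m' x) * (m x - m' x).
Hypothesis F_hemicont : forall k m m' x, (k <= N)%N -> weights (S k) m ->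
  weights (S k) m' -> x \in S k ->
  F k (segment t m m') x @[t --> 0^'+] --> F k m x.

Definition occ_index := (nat * X * Y)%type.

(** The mass that [w] sends into each state, not the mass leaving it: the final time [N] thus has a
    marginal too, and [occ] is a balance between the two. *)
Definition marg (w : occ_index -> R) k : X -> R :=
  if k is k'.+1 then
    fun y => \sum_(x <- S k') \sum_(a <- U k' x) w (k', x, a) * Q k' x a y
  else m0.

(* Occupation measures; the values of w at irrelevant indices are only
   constrained to lie in [0, 1]. *)
Definition occ : set (@fspace R occ_index) :=
  [set w | (forall i, 0 <= w i <= 1) /\
     forall k x, (k < N)%N -> x \in S k ->
     \sum_(a <- U k x) w (k, x, a) = marg w k x].

Lemma value_last M : value M N = F N (M N).
Proof. by rewrite /value subnn. Qed.

Lemma value_step M k x : (k < N)%N ->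
  value M k x = softmin eps (qvalue M k (value M k.+1) x) (U k x).
Proof.
move=> kN; rewrite /value; have -> : (N - k = (N - k.+1).+1)%N by rewrite -subSn.
by rewrite /= -subSn// subSS subKn// ltnW.
Qed.

Lemma marg_cvxcomb (J : finType) (mu : J -> R) (u : J -> occ_index -> R) k :
  simplex mu -> marg (cvxcomb mu u) k = cvxcomb mu (fun j => marg (u j) k).
Proof.
move=> [mu0 mu1]; apply/funext => y; rewrite /cvxcomb; case: k => [|k] /=.
  by rewrite -mulr_suml mu1 mul1r.
under [RHS]eq_bigr do rewrite mulr_sumr.
rewrite [RHS]exchange_big; apply: eq_bigr => x _ /=.
under [RHS]eq_bigr do rewrite mulr_sumr.
rewrite [RHS]exchange_big; apply: eq_bigr => a _ /=.
by rewrite mulr_suml; apply: eq_bigr => j _; rewrite mulrA.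
Qed.

Lemma marg_segment t u v k : 0 <= t <= 1 ->
  marg (segment t u v) k = segment t (marg u k) (marg v k).
Proof.
move=> t01; rewrite !segment_cvxcomb marg_cvxcomb; last exact: simplex_bool.
by congr cvxcomb; apply/funext; case.
Qed.

Lemma marg_weights w k : occ w -> (k <= N)%N -> weights (S k) (marg w k).
Proof.
move=> [w01 wm]; elim: k => [//|k IH] kN.
have [_ _ IHs] := IH (ltnW kN).
split=> [y|y yS|] /=.
- rewrite big_seq; apply: sumr_ge0 => x xS; rewrite big_seq; apply: sumr_ge0 => a aU.
  by apply: mulr_ge0; [case/andP: (w01 (k, x, a)) | exact: Q_ge0].
- rewrite big_seq big1// => x xS; rewrite big_seq big1// => a aU.
  by rewrite Q_out// mulr0.
- rewrite -[RHS]IHs exchange_big /= big_seq [RHS]big_seq; apply: eq_bigr => x xS.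
  rewrite exchange_big /= -wm// big_seq [RHS]big_seq; apply: eq_bigr => a aU.
  by rewrite -mulr_sumr Q_sum// mulr1.
Qed.

Lemma occ_le_marg w k x a : occ w -> (k < N)%N -> x \in S k -> a \in U k x ->
  0 <= w (k, x, a) <= marg w k x.
Proof.
move=> [w01 wm] kN xS aU; have [-> _] := andP (w01 (k, x, a)).
rewrite -wm// (perm_big _ (perm_to_rem aU))/= big_cons lerDl.
by apply: sumr_ge0 => b _; case/andP: (w01 (k, x, b)).
Qed.

Lemma occ_closed : closed occ.
Proof.
have coordc (i : occ_index) := @eval_continuous R occ_index i.
have margc k x : continuous (fun w : @fspace R occ_index => marg w k x).
  case: k => [|k] /=; first exact: const_continuous.
  apply: sum_continuous => y; apply: sum_continuous => a.
  by apply: mulrr_continuous; exact: coordc.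
rewrite (_ : occ = (\bigcap_i ((fun w : @fspace R occ_index => w i) @^-1` [set z | 0 <= z]))
  `&` (\bigcap_i ((fun w : @fspace R occ_index => w i) @^-1` [set z | z <= 1]))
  `&` (\bigcap_(kx in [set kx : nat * X | (kx.1 < N)%N && (kx.2 \in S kx.1)])
     (fun w : @fspace R occ_index => \sum_(a <- U kx.1 kx.2) w (kx, a) + -1 * marg w kx.1 kx.2)
       @^-1` [set z | z = 0])).
  apply: closedI; first apply: closedI; apply: closed_bigI => i _.
  - exact: closed_preimage (coordc i) (closed_ge (y := 0)).
  - exact: closed_preimage (coordc i) (closed_le (y := 1)).
  - apply: closed_preimage (closed_eq (y := 0)).
    apply: add_continuous; last by apply: mulrl_continuous; exact: margc.
    by apply: sum_continuous => a; exact: coordc.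
apply/seteqP; split=> [w [w01 wm]|w [[w0 w1] wm]].
  split; first by split=> i _ /=; case/andP: (w01 i).
  by move=> [k x] /= /andP[kN xS]; rewrite wm// mulN1r subrr.
split=> [i|k x kN xS]; first by rewrite w0 ?w1.
have := wm (k, x); rewrite /= kN xS => /(_ isT) /eqP.
by rewrite mulN1r subr_eq0 => /eqP.
Qed.

Lemma occ_compact : compact occ.
Proof.
apply: (@subclosed_compact _ _ [set f : @fspace R occ_index | forall i, `[0 : R, 1]%classic (f i)]).
- exact: occ_closed.
- by apply: (@tychonoff occ_index (fun=> R) (fun=> `[0, 1]%classic)) => j; exact: segment_compact.
- by move=> w [w01 _] i /=; rewrite in_itv /= w01.
Qed.

Lemma occ_convex (J : finType) (mu : J -> R) (u : J -> occ_index -> R) :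
  simplex mu -> (forall j, occ (u j)) -> occ (cvxcomb mu u).
Proof.
move=> mus ou; have [mu0 mu1] := mus; split=> [i|k x kN xS].
  apply/andP; split.
    by apply: sumr_ge0 => j _; apply: mulr_ge0 => //; have [/(_ i)/andP[]] := ou j.
  rewrite -mu1; apply: ler_sum => j _; apply: ler_piMr => //.
  by have [/(_ i)/andP[]] := ou j.
rewrite marg_cvxcomb// /cvxcomb exchange_big; apply: eq_bigr => j _ /=.
by rewrite -mulr_sumr; have [_ ->] := ou j.
Qed.

Definition lin_cost (M : nat -> X -> R) (w : occ_index -> R) :=
  \sum_(k < N) \sum_(x <- S k) \sum_(a <- U k x) w (k : nat, x, a) * c k x a
  + \sum_(k < N.+1) \sum_(x <- S k) F k (M k) x * marg w k x.

(** On [occ], [eps] times the entropy of the action conditionally on the state. Written with [xlnx],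
    it is continuous on the whole space. *)
Definition ent_cost (w : occ_index -> R) :=
  eps * \sum_(k < N) \sum_(x <- S k)
    (\sum_(a <- U k x) xlnx (w (k : nat, x, a)) + -1 * xlnx (marg w k x)).

Lemma ent_costE w : occ w -> ent_cost w =
  eps * \sum_(k < N) \sum_(x <- S k) \sum_(a <- U k x)
    w (k : nat, x, a) * (ln (w (k : nat, x, a)) - ln (marg w k x)).
Proof.
move=> [w01 wm]; congr (_ * _); apply: eq_bigr => k _.
apply: eq_big_seq => x xS; rewrite /xlnx -[in X in _ + _ * (X * _)]wm//.
rewrite mulrA mulr_sumr mulr_suml -big_split /=.
by apply: eq_bigr => a _; ring.
Qed.

Definition relent (p : nat -> X -> Y -> R) (w : occ_index -> R) :=
  \sum_(k < N) \sum_(x <- S k) \sum_(a <- U k x)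
    w (k : nat, x, a) * (ln (w (k : nat, x, a)) - ln (marg w k x) - ln (p k x a)).

(* Bellman's equation, multiplied by the occupation measure and telescoped. *)
Lemma performance M w : occ w -> lin_cost M w + ent_cost w =
  \sum_(x <- S 0) m0 x * value M 0 x + eps * relent (policy M) w.
Proof.
move=> ow; have [w01 wm] := ow.
rewrite ent_costE// /lin_cost big_ord_recr /= -/(marg w N).
pose E k := \sum_(x <- S k) marg w k x * value M k x.
have step (k : 'I_N) :
  \sum_(x <- S k) \sum_(a <- U k x) w (k : nat, x, a) * c k x a
  + \sum_(x <- S k) F k (M k) x * marg w k x
  + eps * \sum_(x <- S k) \sum_(a <- U k x)
    w (k : nat, x, a) * (ln (w (k : nat, x, a)) - ln (marg w k x))
  = eps * \sum_(x <- S k) \sum_(a <- U k x)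
    w (k : nat, x, a) * (ln (w (k : nat, x, a)) - ln (marg w k x) - ln (policy M k x a))
    + (E k - E k.+1).
  have -> : E k.+1 = \sum_(x <- S k) \sum_(a <- U k x)
      w (k : nat, x, a) * \sum_(y <- S k.+1) Q k x a y * value M k.+1 y.
    rewrite /E /=; under eq_bigr do rewrite mulr_suml.
    rewrite exchange_big; apply: eq_bigr => x _ /=.
    under eq_bigr do rewrite mulr_suml.
    rewrite exchange_big; apply: eq_bigr => a _ /=.
    by rewrite mulr_sumr; apply: eq_bigr => y _; rewrite mulrA.
  rewrite /E !mulr_sumr -sumrB -!big_split /=; apply: eq_big_seq => x xS.
  rewrite -wm// !mulr_sumr mulr_suml -sumrB -!big_split /=; apply: eq_big_seq => a aU.
  (* For every action, not only on average, [value] is [qvalue] plus [eps] times the logarithm of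
     [policy]; hence an identity rather than an inequality. *)
  rewrite value_step// -(softargmin_eq eps_gt0 _ aU) -/(policy M k x a) /qvalue; ring.
have -> : \sum_(x <- S 0) m0 x * value M 0 x = E 0 by [].
have -> : \sum_(x <- S N) F N (M N) x * marg w N x = E N.
  by rewrite /E value_last; apply: eq_bigr => x _; rewrite mulrC.
have tel : \sum_(k < N) (E k - E k.+1) = E 0%N - E N.
  rewrite -(big_mkord xpredT (fun k => E k - E k.+1)).
  by under eq_bigr do rewrite -opprB; rewrite sumrN telescope_sumr// opprB.
have : \sum_(k < N) (eps * (\sum_(x <- S k) \sum_(a <- U k x)
    w (k : nat, x, a) * (ln (w (k : nat, x, a)) - ln (marg w k x) - ln (policy M k x a)))
    + (E k - E k.+1)) = eps * relent (policy M) w + (E 0%N - E N).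
  by rewrite big_split /= -mulr_sumr tel.
rewrite -(eq_bigr _ (fun k _ => step k)) !big_split /= -mulr_sumr; lra.
Qed.

Lemma policy_ge0 M k x a : 0 <= policy M k x a.
Proof. exact: softargmin_ge0. Qed.

Lemma policy_sum M k x : (k < N)%N -> x \in S k -> \sum_(a <- U k x) policy M k x a = 1.
Proof. by move=> kN xS; exact/softargmin_sum/U_neq0. Qed.

(* The parts w - m pi subtracted in [t] below have zero sum and make every term
   nonnegative. *)
Lemma relent_le0 M w : occ w -> relent (policy M) w <= 0 ->
  forall k x a, (k < N)%N -> x \in S k -> a \in U k x ->
  w (k, x, a) = marg w k x * policy M k x a.
Proof.
move=> ow le0; have [_ wm] := ow.
pose t k x a := w (k, x, a) * (ln (w (k, x, a)) - ln (marg w k x) - ln (policy M k x a))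
  - (w (k, x, a) - marg w k x * policy M k x a).
have t0 k x a : (k < N)%N -> x \in S k -> a \in U k x -> 0 <= t k x a.
  move=> kN xS aU.
  have := relent_tangent (occ_le_marg ow kN xS aU) (softargmin_gt0 eps (qvalue M k (value M k.+1) x) aU).
  rewrite -/(policy M k x a) /t; lra.
have tS : \sum_(k < N) \sum_(x <- S k) \sum_(a <- U k x) t k x a <= 0.
  apply: le_trans le0; rewrite /relent; apply: ler_sum => k _.
  rewrite big_seq [leRHS]big_seq; apply: ler_sum => x xS.
  rewrite sumrB (sumrB _ _ (fun a => w (k : nat, x, a))) -mulr_sumr policy_sum// mulr1.
  by rewrite wm// subrr subr0.
move=> k x a kN xS aU.
have tx x' : x' \in S k -> 0 <= \sum_(a <- U k x') t k x' a.
  by move=> x'S; rewrite big_seq; apply: sumr_ge0 => b bU; exact: t0.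
have : \sum_(x <- S k) \sum_(a <- U k x) t k x a = 0.
  have := @sum_eq0_ge0_seq R 'I_N (index_enum _) (fun k => \sum_(x <- S k) \sum_(a <- U k x) t k x a).
  move=> /(_ _ tS (Ordinal kN)) /=; apply; last by rewrite mem_index_enum.
  move=> k' _; rewrite big_seq; apply: sumr_ge0 => x' x'S.
  by rewrite big_seq; apply: sumr_ge0 => b bU; exact: t0.
move=> /eqP; rewrite eq_le => /andP[/(sum_eq0_ge0_seq tx)/(_ _ xS) + _].
move=> /eqP; rewrite eq_le => /andP[/(sum_eq0_ge0_seq (fun b bU => t0 k x b kN xS bU))/(_ _ aU) tE _].
apply: (relent_tangent_eq (occ_le_marg ow kN xS aU)
  (softargmin_gt0 eps (qvalue M k (value M k.+1) x) aU)).
move: tE; rewrite -/(policy M k x a) /t; lra.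
Qed.

(** Optimality forces [relent] to be at most 0, so [w] factors as [marg w] times the Gibbs policy,
    and its marginals obey the recursion that defines [dist]. *)
Lemma optimal_marg M w : occ w ->
  lin_cost M w + ent_cost w <= \sum_(x <- S 0) m0 x * value M 0 x ->
  forall k, (k <= N)%N -> marg w k = dist (policy M) k.
Proof.
move=> ow; rewrite performance// gerDl pmulr_rle0// => /(relent_le0 ow) wE.
elim=> [//|k IH] kN; apply/funext => y /=.
apply: eq_big_seq => x xS; apply: eq_big_seq => a aU.
by rewrite wE// IH// ltnW.
Qed.

Lemma dist_weights M k : (k <= N)%N -> weights (S k) (dist (policy M) k).
Proof.
elim: k => [//|k IH] kN; have [IH0 _ IHs] := IH (ltnW kN).
split=> [y|y yS|] /=.
- rewrite big_seq; apply: sumr_ge0 => x xS; rewrite big_seq; apply: sumr_ge0 => a aU.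
  by apply: mulr_ge0; [exact: mulr_ge0 (policy_ge0 _ _ _ _) | exact: Q_ge0].
- rewrite big_seq big1// => x xS; rewrite big_seq big1// => a aU.
  by rewrite Q_out// mulr0.
- rewrite -[RHS]IHs exchange_big /= big_seq [RHS]big_seq; apply: eq_bigr => x xS.
  rewrite exchange_big /= -[RHS]mulr1 -(policy_sum M kN xS) mulr_sumr.
  rewrite big_seq [RHS]big_seq; apply: eq_bigr => a aU.
  by rewrite -mulr_sumr Q_sum// mulr1.
Qed.

(** The value 0 at irrelevant indices secures the bounds required in [occ], since nothing is assumed
    on [U] and [Q] there. *)
Definition occ_of M : occ_index -> R := fun i =>
  if (i.1.1 < N)%N && (i.1.2 \in S i.1.1) then
    dist (policy M) i.1.1 i.1.2 * policy M i.1.1 i.1.2 i.2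
  else 0.

Lemma occ_ofE M k x a : (k < N)%N -> x \in S k ->
  occ_of M (k, x, a) = dist (policy M) k x * policy M k x a.
Proof. by move=> kN xS; rewrite /occ_of /= kN xS. Qed.

Lemma occ_of_marg M k : (k <= N)%N -> marg (occ_of M) k = dist (policy M) k.
Proof.
case: k => [//|k] kN; apply/funext => y /=.
apply: eq_big_seq => x xS; apply: eq_big_seq => a aU.
by rewrite occ_ofE.
Qed.

Lemma sum_ge_term (I : eqType) (s : seq I) (f : I -> R) i :
  (forall i, 0 <= f i) -> i \in s -> f i <= \sum_(j <- s) f j.
Proof.
by move=> f0 si; rewrite (perm_big _ (perm_to_rem si))/= big_cons lerDl sumr_ge0.
Qed.

Lemma occ_of_occ M : occ (occ_of M).
Proof.
split=> [[[k x] a]|k x kN xS]; last first.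
  rewrite occ_of_marg ?(ltnW kN)//; under eq_bigr do rewrite occ_ofE//.
  by rewrite -mulr_sumr policy_sum// mulr1.
have [/andP[kN xS]|h] := boolP ((k < N)%N && (x \in S k)); last first.
  by rewrite /occ_of /= (negbTE h) lexx ler01.
have [d0 _ d1] := dist_weights M (ltnW kN).
rewrite occ_ofE// mulr_ge0 ?policy_ge0//= mulr_ile1 ?policy_ge0//.
  by rewrite -d1; exact: sum_ge_term.
have [aU|aU] := boolP (a \in U k x); last by rewrite /policy softargmin_out// ler01.
by rewrite -(policy_sum M kN xS); apply: sum_ge_term => // b; exact: policy_ge0.
Qed.

Lemma occ_of_optimal M :
  lin_cost M (occ_of M) + ent_cost (occ_of M) = \sum_(x <- S 0) m0 x * value M 0 x.
Proof.
rewrite performance; last exact: occ_of_occ.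
rewrite -[RHS]addr0; congr (_ + _); rewrite /relent.
rewrite big1 ?mulr0// => k _; rewrite big_seq big1// => x xS; rewrite big_seq big1// => a aU.
have kN := ltn_ord k.
rewrite occ_of_marg ?(ltnW kN)// occ_ofE//.
have [->|dn] := eqVneq (dist (policy M) k x) 0; first by rewrite !mul0r.
have d0 : 0 < dist (policy M) k x.
  by apply: ge0_neq_gt0 => //; case: (dist_weights M (ltnW kN)).
by rewrite lnM ?posrE//; [ring | exact: softargmin_gt0].
Qed.

(** The Lasry-Lions cancellation: the control costs do not see the crowd and drop out, leaving minus
    the sums of [F_monotone] over all times. *)
Lemma lin_cost_cross M M' w w' :
  (forall k, (k <= N)%N -> marg w k = M k) ->
  (forall k, (k <= N)%N -> marg w' k = M' k) ->
  (forall k, (k <= N)%N -> weights (S k) (M k)) ->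
  (forall k, (k <= N)%N -> weights (S k) (M' k)) ->
  lin_cost M w' - lin_cost M w + (lin_cost M' w - lin_cost M' w') <= 0.
Proof.
move=> wM wM' mM mM'; rewrite /lin_cost.
set A := \sum_(k < N) _; set A' := \sum_(k < N) _.
suff : 0 <= \sum_(k < N.+1) \sum_(x <- S k) F k (M k) x * marg w k x
  - \sum_(k < N.+1) \sum_(x <- S k) F k (M k) x * marg w' k x
  - (\sum_(k < N.+1) \sum_(x <- S k) F k (M' k) x * marg w k x
  - \sum_(k < N.+1) \sum_(x <- S k) F k (M' k) x * marg w' k x) by lra.
rewrite -!sumrB; apply: sumr_ge0 => k _; have kN : (k <= N)%N := ltn_ord k.
rewrite wM// wM'// -!sumrB.
apply: le_trans (F_monotone kN (mM _ kN) (mM' _ kN)) _.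
by rewrite le_eqVlt; apply/orP; left; apply/eqP; apply: eq_bigr => x _; ring.
Qed.

(** By [cross] and the optimality of both best responses, [occ_of M'] is optimal against [M] as
    well; all optimal measures against [M] have the same marginals. *)
Theorem finite_mfg_unique M M' :
  (forall k, (k <= N)%N -> M k = dist (policy M) k) ->
  (forall k, (k <= N)%N -> M' k = dist (policy M') k) ->
  forall k, (k <= N)%N -> M k = M' k.
Proof.
move=> fM fM'.
have wM k : (k <= N)%N -> marg (occ_of M) k = M k by move=> kN; rewrite occ_of_marg// -fM.
have wM' k : (k <= N)%N -> marg (occ_of M') k = M' k by move=> kN; rewrite occ_of_marg// -fM'.
have mM k : (k <= N)%N -> weights (S k) (M k) by move=> kN; rewrite fM//; exact: dist_weights.
have mM' k : (k <= N)%N -> weights (S k) (M' k) by move=> kN; rewrite fM'//; exact: dist_weights.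
have cross := lin_cost_cross wM wM' mM mM'.
have o1 := occ_of_optimal M; have o2 := occ_of_optimal M'.
have lb : \sum_(x <- S 0) m0 x * value M' 0 x <= lin_cost M' (occ_of M) + ent_cost (occ_of M).
  (* A negative [relent] would, by [relent_le0], make [occ_of M] factor through the policy of [M'],
     and then every term of [relent] vanishes. *)
  rewrite leNgt; apply/negP => lt.
  have kl := relent_le0 (occ_of_occ M) (M := M').
  move: lt; rewrite performance; last exact: occ_of_occ.
  rewrite gtrDl pmulr_rlt0// => lt; move: (lt); rewrite ltNge => /negP; apply.
  have {}kl := kl (ltW lt).
  rewrite le_eqVlt; apply/orP; left; apply/eqP/esym.
  rewrite /relent big1// => k _; rewrite big_seq big1// => x xS; rewrite big_seq big1// => a aU.
  have kN := ltn_ord k; rewrite kl//.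
  have [->|dn] := eqVneq (marg (occ_of M) k x) 0; first by rewrite !mul0r.
  have d0 : 0 < marg (occ_of M) k x.
    by apply: ge0_neq_gt0 => //; rewrite wM ?(ltnW kN)//; case: (mM k (ltnW kN)).
  by rewrite lnM ?posrE//; [ring | exact: softargmin_gt0].
move=> k kN; rewrite fM// -wM'//; symmetry.
apply: optimal_marg => //; first exact: occ_of_occ.
lra.
Qed.

Theorem finite_mfg_exists : exists M : nat -> X -> R,
  forall k, (k <= N)%N -> weights (S k) (M k) /\ M k = dist (policy M) k.
Proof.
have [|||||||||u ou uopt] := @minty R occ_index occ (fun u w => lin_cost (marg u) w) ent_cost.
- by exists (occ_of (fun _ _ => 0)); exact: occ_of_occ.
- exact: occ_compact.
- exact: occ_convex.
- move=> J mu u w mus ou ow; rewrite /lin_cost.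
  under [RHS]eq_bigr do rewrite mulrDr !mulr_sumr.
  rewrite [RHS]big_split /= [in RHS]exchange_big /=; congr (_ + _).
    apply: eq_bigr => k _.
    under [RHS]eq_bigr do rewrite mulr_sumr.
    rewrite [RHS]exchange_big /=; apply: eq_bigr => x _.
    under [RHS]eq_bigr do rewrite mulr_sumr.
    rewrite [RHS]exchange_big /=; apply: eq_bigr => a _.
    by rewrite /cvxcomb mulr_suml; apply: eq_bigr => j _; rewrite mulrA.
  rewrite [RHS]exchange_big /=; apply: eq_bigr => k _.
  under [RHS]eq_bigr do rewrite mulr_sumr.
  rewrite [RHS]exchange_big /=; apply: eq_bigr => x _.
  rewrite marg_cvxcomb// /cvxcomb mulr_sumr; apply: eq_bigr => j _.
  by rewrite mulrCA.
(* After [ent_costE] each term is jointly convex in [w] and [marg w], and [marg] is affine. *)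
- move=> J mu u mus ou; rewrite ent_costE; last exact: occ_convex.
  under [leRHS]eq_bigr do rewrite ent_costE//.
  rewrite -subr_ge0; under eq_bigr do rewrite mulrCA mulr_sumr.
  rewrite -mulr_sumr -mulrBr; apply: mulr_ge0; first exact: ltW.
  rewrite subr_ge0 exchange_big /=; apply: ler_sum => k _; have kN := ltn_ord k.
  under [leRHS]eq_bigr do rewrite mulr_sumr.
  rewrite [leRHS]exchange_big /= big_seq [leRHS]big_seq; apply: ler_sum => x xS.
  under [leRHS]eq_bigr do rewrite mulr_sumr.
  rewrite [leRHS]exchange_big /= big_seq [leRHS]big_seq; apply: ler_sum => a aU.
  rewrite marg_cvxcomb// /cvxcomb; apply: relent_convex => // j.
  exact: occ_le_marg.
- move=> w ow; rewrite /lin_cost.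
  apply: add_continuous; apply: sum_continuous => k; apply: sum_continuous => x.
    by apply: sum_continuous => a; apply: mulrr_continuous; exact: eval_continuous.
  apply: mulrl_continuous; case: (k : nat) => [|k'] /=; first exact: const_continuous.
  apply: sum_continuous => y; apply: sum_continuous => a.
  by apply: mulrr_continuous; exact: eval_continuous.
- apply: mulrl_continuous; apply: sum_continuous => k; apply: sum_continuous => x.
  have xc (G : @fspace R occ_index -> R) : continuous G -> continuous (fun w => xlnx (G w)).
    by move=> Gc w; apply: continuous_comp; [exact: Gc | exact: xlnx_continuous].
  apply: add_continuous.
    by apply: sum_continuous => a; apply: xc; exact: eval_continuous.
  apply: mulrl_continuous; apply: xc.
  case: (k : nat) => [|k'] /=; first exact: const_continuous.
  apply: sum_continuous => y; apply: sum_continuous => a.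
  by apply: mulrr_continuous; exact: eval_continuous.
- move=> u v ou ov.
  by apply: lin_cost_cross => // k kN; exact: marg_weights.
(* Only the crowd argument of [F] moves with [t], and the marginals of a segment form a segment. *)
- move=> u v w ou ov ow; rewrite /lin_cost; apply: cvgD; first exact: cvg_cst.
  apply: sum_cvg => k _; have kN : (k <= N)%N := ltn_ord k.
  apply: sum_cvg => x xS; apply: cvgMl.
  have := F_hemicont kN (marg_weights ou kN) (marg_weights ov kN) xS.
  apply: cvg_trans; apply: near_eq_cvg; near=> t.
  by rewrite marg_segment//; apply/andP; split; near: t; [exact: nbhs_right_ge | exact: nbhs_right_le].
exists (marg u) => k kN; split; first exact: marg_weights.
(* Tested against the best response to its own marginals, [u] costs no more, hence attains the
   optimal value. *)
apply: optimal_marg => //; rewrite -occ_of_optimal.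
have := uopt _ (occ_of_occ (marg u)); lra.
Unshelve. all: by end_near. Qed.

End FiniteMFG.
(** * Finitely supported measures *)

Section DiscreteProbability.
Context d (T : measurableType d) {R : realType}.

Section Construction.
Variables (n : nat) (w : nat -> {nonneg R}) (z : nat -> T).
Hypothesis w1 : \sum_(i < n) (w i)%:num = 1.

Definition discrete_measure : set T -> \bar R :=
  msum (fun i => mscale (w i) \d_(z i)) n.

HB.instance Definition _ := Measure.on discrete_measure.

Lemma discrete_measureE X : measurable X ->
  discrete_measure X = (\sum_(i < n) (w i)%:num * \1_X (z i))%:E.
Proof.
move=> mX; rewrite /discrete_measure /= /msum -sumEFin; apply: eq_bigr => i _.
by transitivity ((w i)%:num%:E * dirac (z i) X)%E.
Qed.

Lemma discrete_measure_setT : discrete_measure setT = 1%E.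
Proof.
rewrite discrete_measureE//; under eq_bigr do rewrite indicT mulr1.
by rewrite w1.
Qed.

HB.instance Definition _ := @Measure_isProbability.Build d T R
  discrete_measure discrete_measure_setT.

Definition discrete_prob : probability T R := discrete_measure.

Lemma discrete_prob_integral (h : T -> \bar R) : measurable_fun setT h ->
  (forall x, 0 <= h x)%E ->
  (\int[discrete_prob]_x h x = \sum_(i < n) (w i)%:num%:E * h (z i))%E.
Proof.
move=> mh h0.
transitivity (\int[msum (fun i => mscale (w i) \d_(z i)) n]_x h x)%E.
  exact: eq_measure_integral.
rewrite ge0_integral_measure_sum//; apply: eq_bigr => i _.
by rewrite ge0_integral_mscale// integral_dirac// diracT mul1e.
Qed.
End Construction.

(** The space is arbitrary because this produces both the measures on [borel n] and the transport
    plan on pairs in [d1_segment]. *)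
Lemma discrete_probability (J : choiceType) (s : seq J) (w : J -> R) (z : J -> T) :
  (forall j, 0 <= w j) -> \sum_(j <- s) w j = 1 ->
  exists P : probability T R,
    (forall X, measurable X -> P X = (\sum_(j <- s) w j * \1_X (z j))%:E) /\
    (forall h : T -> \bar R, measurable_fun setT h -> (forall x, 0 <= h x)%E ->
       \int[P]_x h x = \sum_(j <- s) (w j)%:E * h (z j))%E.
Proof.
move=> w0 w1.
case: s w1 => [|j0 s']; first by rewrite big_nil => /esym/eqP; rewrite oner_eq0.
set s := j0 :: s' => w1.
pose w' i := NngNum (w0 (nth j0 s i)).
have w'1 : \sum_(i < size s) (w' i)%:num = 1.
  by rewrite -w1 (big_nth j0) big_mkord.
exists (discrete_prob (fun i => z (nth j0 s i)) w'1); split=> [X mX|h mh h0].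
  by rewrite /discrete_prob /= discrete_measureE// (big_nth j0) big_mkord.
by rewrite discrete_prob_integral// (big_nth j0) big_mkord.
Qed.

End DiscreteProbability.

(** * Weights as Borel measures, and their [d1] distance along segments *)

Section DiscreteMeasures.
Context {R : realType} (n : nat).
Local Notation D := 'cV[R]_n.
Implicit Types (s : seq D) (q : D -> R) (h : D -> R).

Lemma borel_measurable_fun h : continuous h ->
  measurable_fun setT (h : borel n -> R).
Proof.
move=> /continuousP ch; apply: (measurability _ (RGenOpens.measurableE R)).
move=> _ [_ [a [b ->] <-]]; rewrite setTI; apply: sub_sigma_algebra.
exact/ch/interval_open.
Qed.

(** Pairs carry the product sigma-algebra, for which continuity does not directly give
    measurability; but the maximum norm is a finite maximum of coordinate differences. *)
Lemma measurable_dist :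
  measurable_fun setT (fun z : borel n * borel n => `|(z.1 : D) - z.2|).
Proof.
have cm (i : 'I_n * 'I_1) : measurable_fun setT ((fun x : D => x i.1 i.2) : borel n -> R).
  by apply: borel_measurable_fun; exact: coord_continuous.
rewrite (_ : (fun z => _) = (fun z : borel n * borel n =>
   \big[Num.max/0]_(i : 'I_n * 'I_1) `|(z.1 : D) i.1 i.2 - (z.2 : D) i.1 i.2|)); last first.
  apply/funext => z; rewrite /Num.Def.normr /= mx_normrE.
  by apply: eq_bigr => i _; rewrite !mxE.
elim: (index_enum _) => [|i l IH].
  under eq_fun do rewrite big_nil; exact: measurable_cst.
under eq_fun do rewrite big_cons; apply: measurable_maxr => //.
apply: measurableT_comp => //; apply: measurable_funB.
  exact: (measurableT_comp (cm i) measurable_fst).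
exact: (measurableT_comp (cm i) measurable_snd).
Qed.

Section MeasureOf.
Variables (s : seq D) (q : D -> R).
Hypothesis s_uniq : uniq s.
Hypothesis qs : weights s q.

Lemma fsbig_weights (X : set D) : \sum_(x \in X) q x = \sum_(x <- s) q x * \1_X x.
Proof.
have [_ q0 _] := qs; rewrite fsbig_mkcond [RHS]fsbig_seq//.
transitivity (\sum_(x \in [set` s]) patch (fun=> 0) X q x).
  symmetry; apply: fsbig_widen => // x [_ /= xs]; rewrite /patch; case: ifP => // _.
  by rewrite q0//; apply/negP.
by apply: eq_fsbigr => x _; rewrite /patch indicE; case: (x \in X); rewrite ?mulr1 ?mulr0.
Qed.

(** A combination of Dirac masses lies in the set from which [measure_of] chooses, so the default
    value does not occur. *)
Lemma measure_ofE (X : set (borel n)) : measurable X ->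
  measure_of q X = (\sum_(x <- s) q x * \1_X x)%:E.
Proof.
move=> mX; have [q0 _ q1] := qs.
have [P [PE _]] := @discrete_probability _ (borel n) R D s q id q0 q1.
rewrite /measure_of; case: xgetP => [mu _ /= ->//|/(_ P)/= []].
  by rewrite fsbig_weights.
by move=> Y mY; rewrite PE// fsbig_weights.
Qed.

Lemma integral_measure_of (h : borel n -> \bar R) : measurable_fun setT h ->
  (forall x, 0 <= h x)%E ->
  (\int[measure_of q]_x h x = \sum_(x <- s) (q x)%:E * h x)%E.
Proof.
move=> mh h0; have [q0 _ q1] := qs.
have [P [PE Ph]] := @discrete_probability _ (borel n) R D s q id q0 q1.
rewrite -Ph//; apply: eq_measure_integral => X mX _.
exact: etrans (measure_ofE mX) (esym (PE X mX)).
Qed.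

Lemma Rintegral_measure_of (h : D -> R) : continuous h ->
  \int[measure_of q]_(x in setT) h x = \sum_(x <- s) q x * h x.
Proof.
move=> /borel_measurable_fun/measurable_EFinP mh; rewrite /Rintegral integralE.
rewrite !integral_measure_of//; [|exact: measurable_funeneg|exact: measurable_funepos].
under eq_bigr do rewrite funeposE -EFin_max -EFinM.
under [X in (_ - X)%E]eq_bigr do rewrite funenegE -EFinN -EFin_max -EFinM.
rewrite !sumEFin -EFinB /= -sumrB; apply: eq_bigr => x _.
rewrite -mulrBr; congr (_ * _); rewrite /Order.max.
by case: ltP => ?; case: ltP => ? //; lra.
Qed.

Lemma measure_of_P1 : in_P1 (measure_of q : prob R n).
Proof.
rewrite /in_P1 integral_measure_of//.
  by under eq_bigr do rewrite -EFinM; rewrite sumEFin ltry.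
apply/measurable_EFinP; apply: (@borel_measurable_fun (fun x : D => `|x|)).
exact: norm_continuous.
Qed.

End MeasureOf.

Lemma weights_segment s q q' t : 0 <= t <= 1 -> weights s q -> weights s q' ->
  weights s (segment t q q').
Proof.
move=> /andP[t0 t1] [a0 ao a1] [b0 bo b1]; split=> [x|x xs|].
- by rewrite addr_ge0// mulr_ge0// subr_ge0.
- by rewrite /segment ao// bo// !mulr0 addr0.
- by rewrite big_split /= -!mulr_sumr a1 b1; ring.
Qed.

(* The plan leaves the mass (1 - t) q in place and transports t q' to q
   independently. *)
Lemma d1_segment s q q' t : uniq s -> weights s q -> weights s q' -> 0 <= t <= 1 ->
  (d1 (measure_of (segment t q q')) (measure_of q) <=
   (t * \sum_(x <- s) \sum_(y <- s) q' x * q y * `|x - y|)%:E)%E.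
Proof.
move=> us wq wq' t01; have [q0 _ q1] := wq; have [q'0 _ q'1] := wq'.
have wt := weights_segment t01 wq wq'.
have [t0 t1] := andP t01.
pose w (z : D * D) := (1 - t) * q z.1 * (z.1 == z.2)%:R + t * (q' z.1 * q z.2).
pose l := [seq (x, y) | x <- s, y <- s].
have w0 z : 0 <= w z.
  by rewrite addr_ge0// !mulr_ge0// subr_ge0.
have lsum (G : D * D -> R) : \sum_(z <- l) G z = \sum_(x <- s) \sum_(y <- s) G (x, y).
  by rewrite /l big_allpairs_dep.
have diag x : x \in s -> \sum_(y <- s) (x == y)%:R = 1 :> R.
  move=> xs; rewrite (bigD1_seq x)//= eqxx big1 ?addr0// => y.
  by rewrite eq_sym => /negbTE ->.
have margl x : x \in s -> \sum_(y <- s) w (x, y) = segment t q q' x.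
  move=> xs; rewrite /w big_split /= -!mulr_sumr diag// q1; rewrite /segment; ring.
have margr y : y \in s -> \sum_(x <- s) w (x, y) = q y.
  move=> ys; rewrite /w big_split /= -mulr_sumr -mulr_suml q'1.
  rewrite (bigD1_seq y)//= eqxx big1 ?addr0; last by move=> x /negbTE ->; rewrite mulr0.
  by rewrite mulr1; ring.
have w1 : \sum_(z <- l) w z = 1.
  rewrite lsum -[RHS](_ : \sum_(x <- s) segment t q q' x = 1); last by case: wt.
  by apply: eq_big_seq => x xs; rewrite margl.
have [P [PE Ph]] := @discrete_probability _ (borel n * borel n)%type R _ l w id w0 w1.
apply: (@le_trans _ _ (\int[P]_(z in setT) (`|(z.1 : D) - z.2|)%:E)%E).
  apply: ereal_inf_lbound; exists P => // X mX.
  have mXT := measurableX mX (@measurableT _ (@borel R n)).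
  have mTX := measurableX (@measurableT _ (@borel R n)) mX.
  rewrite !PE//.
  rewrite (measure_ofE us wt)// (measure_ofE us wq)// !lsum; split; congr _%:E.
    apply: eq_big_seq => x xs; rewrite -margl// mulr_suml.
    by apply: eq_bigr => y _; rewrite !indicE in_setX in_setT andbT.
  rewrite exchange_big /=; apply: eq_big_seq => y ys; rewrite -margr// mulr_suml.
  by apply: eq_bigr => x _; rewrite !indicE in_setX in_setT.
rewrite Ph//; last by apply/measurable_EFinP; exact: measurable_dist.
under eq_bigr do rewrite -EFinM.
rewrite sumEFin lee_fin lsum mulr_sumr; apply: ler_sum => x _.
rewrite mulr_sumr; apply: ler_sum => y _; rewrite /w /=.
case: eqVneq => [->|_]; first by rewrite subrr normr0 !mulr0.
by rewrite mulr0 add0r !mulrA.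
Qed.

End DiscreteMeasures.
(** * Reachable states *)

Section MatrixNorm.
Context {R : realType}.

Lemma mx_entry_le_norm m n (x : 'M[R]_(m, n)) i j : `|x i j| <= `|x|.
Proof.
by rewrite [leRHS]/Num.Def.normr /= mx_normrE; exact: (le_bigmax _ _ (i, j)).
Qed.

Lemma mx_norm_le m n (x : 'M[R]_(m, n)) b : 0 <= b ->
  (forall i j, `|x i j| <= b) -> `|x| <= b.
Proof.
move=> b0 xb; rewrite [leLHS]/Num.Def.normr /= mx_normrE.
by apply: bigmax_le => // -[i j] _; exact: xb.
Qed.

Lemma col_mx0_norm_le m1 m2 n (v : 'M[R]_(m2, n)) : `|col_mx (0 : 'M[R]_(m1, n)) v| <= `|v|.
Proof.
apply: mx_norm_le => // i j; rewrite mxE; case: (fintype.split i) => k.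
  by rewrite mxE normr0.
exact: mx_entry_le_norm.
Qed.

Lemma mulmx_norm_le m n (X : 'M[R]_(m, n)) (a : 'cV[R]_n) :
  `|X *m a| <= (\sum_i \sum_j `|X i j|) * `|a|.
Proof.
have S0 i : 0 <= \sum_j `|X i j| by apply: sumr_ge0.
apply: mx_norm_le => [|i j]; first by apply: mulr_ge0 => //; apply: sumr_ge0.
rewrite mxE; apply: le_trans (ler_norm_sum _ _ _) _.
apply: (@le_trans _ _ ((\sum_j `|X i j|) * `|a|)).
  rewrite mulr_suml; apply: ler_sum => k _; rewrite normrM ler_wpM2l//.
  exact: mx_entry_le_norm.
by apply: ler_wpM2r => //; rewrite (bigD1 i)//= lerDl sumr_ge0.
Qed.

(** Without an upper bound the [sup] in [opnorm] would be a default value. *)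
Lemma opnorm_has_ubound m n (X : 'M[R]_(m, n)) :
  has_ubound [set `|X *m a| | a in [set a : 'cV[R]_n | `|a| <= 1]].
Proof.
exists (\sum_i \sum_j `|X i j|) => _ [b /= b1 <-].
apply: le_trans (mulmx_norm_le _ _) _; apply: ler_piMr => //.
by apply: sumr_ge0 => i _; apply: sumr_ge0.
Qed.

Lemma opnorm_ge0 m n (X : 'M[R]_(m, n)) : 0 <= opnorm X.
Proof.
apply: ub_le_sup; first exact: opnorm_has_ubound.
by exists 0; rewrite /= ?mulmx0 ?normr0.
Qed.

Lemma opnorm_ge m n (X : 'M[R]_(m, n)) (a : 'cV[R]_n) : `|X *m a| <= opnorm X * `|a|.
Proof.
have [->|a0] := eqVneq a 0; first by rewrite mulmx0 !normr0 mulr0.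
have na : 0 < `|a| by rewrite normr_gt0.
rewrite -ler_pdivrMr//; apply: ub_le_sup; first exact: opnorm_has_ubound.
exists (`|a|^-1 *: a) => /=.
  by rewrite normrZ normfV normr_id mulVf ?gt_eqF.
by rewrite -scalemxAr normrZ normfV normr_id mulrC.
Qed.

End MatrixNorm.

Section GridFinite.
Context {R : realType}.

Lemma grid_ball_finite n Ns b : (0 < Ns)%N ->
  finite_set (@grid R n Ns `&` [set x | `|x| <= b]).
Proof.
move=> Ns0; have Nr : 0 < Ns%:R :> R by rewrite ltr0n.
pose B := Num.bound (b * Ns%:R).
pose h (f : {ffun 'I_n -> 'I_(B + B).+1}) : 'cV[R]_n :=
  \col_i (((f i : nat)%:R - B%:R) * dx Ns).
apply: (@sub_finite_set _ _ (h @` [set: {ffun 'I_n -> 'I_(B + B).+1}])); last first.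
  by apply: finite_image; exact: finite_finset.
move=> x [gx /= xb].
have /choice[z zE] : forall i, exists z : int, x i 0 = z%:~R * dx Ns by exact: gx.
have zB i : (`|z i| <= B)%N.
  rewrite -(ler_nat R) natr_absz intr_norm.
  apply: (@le_trans _ _ (b * Ns%:R)).
    rewrite -ler_pdivrMr// -[leLHS]ger0_norm; last by rewrite divr_ge0// ltW.
    rewrite normrM normr_id -normrM -/(dx Ns) -zE.
    exact: le_trans (mx_entry_le_norm _ _ _) xb.
  have b0 : 0 <= b * Ns%:R by rewrite mulr_ge0 ?(ltW Nr)// (le_trans _ xb).
  by apply/ltW; have := archi_boundP b0.
have zB0 i : 0 <= z i + B%:Z by have := zB i; lia.
have zB1 i : (absz (z i + B%:Z)%R < (B + B).+1)%N by have := zB i; lia.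
exists [ffun i => Ordinal (zB1 i)] => //.
apply/colP => i; rewrite mxE ffunE /= zE natr_absz ger0_norm// intrD.
by rewrite addrK.
Qed.

End GridFinite.
Section Reachable.
Context {R : realType} (T : R) (r s : nat).
Local Notation D := 'cV[R]_(r + s).
Variables (A : R -> D -> D) (B : R -> D -> 'M[R]_(r + s, r)) (LA CB : R).
Variables (m0 : prob R (r + s)) (Chat CI : R).
Variable beta : nat -> 'cV[R]_s -> 'cV[R]_s -> R.
Variables (K : set D) (cK : R) (Nt Ns : nat).

Hypothesis T_gt0 : 0 < T.
Hypothesis dynamics : dynamics_hyp T A B LA CB.
Hypothesis m0_compact : compact (msupp m0).
Hypothesis Chat_gt0 : 0 < Chat.
Hypothesis CI_gt0 : 0 < CI.
Hypothesis beta_basis : Q1_basis Ns CI (beta Ns).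
Hypothesis K_compact : compact K.
Hypothesis K_contains :
  forall k, (k <= Nt)%N -> Kset T A m0 LA CB CI Chat Nt Ns k `<=` K.
Hypothesis cK_gt0 : 0 < cK.
Hypothesis cK_bound : forall (t : R) x, 0 <= t <= T -> K x ->
  opnorm (invmx (usubmx (B t x))) <= cK.
Hypothesis Nt_gt0 : (0 < Nt)%N.
Hypothesis Ns_gt0 : (0 < Ns)%N.
Hypothesis step_ratio : dx Ns / dt T Nt <= Chat / cK.

Local Notation dt := (dt T Nt).
Local Notation dx := (dx Ns).
Local Notation t_ := (tk T Nt).
Local Notation alpha := (alpha T A B Nt).
Local Notation yy2 := (yy2 T A B Nt).
Local Notation S1 := (S1 T A B Chat Nt Ns).
Local Notation S2 := (S2 T A B beta Nt Ns).
Local Notation Snext := (Snext T A B Chat beta Nt Ns).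
Local Notation S_ := (S_ T A B m0 LA CB CI Chat beta Nt Ns).
Local Notation Kset := (Kset T A m0 LA CB CI Chat Nt Ns).

Lemma dt_gt0 : 0 < dt.
Proof. by rewrite /Defs.dt divr_gt0// ltr0n. Qed.

Lemma dx_gt0 : 0 < dx :> R.
Proof. by rewrite /Defs.dx invr_gt0 ltr0n. Qed.

Lemma tk_bounds k : (k <= Nt)%N -> 0 <= t_ k <= T.
Proof.
move=> kN; rewrite /tk /Defs.dt; apply/andP; split.
  by rewrite mulr_ge0// divr_ge0// ltW.
rewrite mulrCA ler_piMr ?(ltW T_gt0)// ler_pdivrMr ?ltr0n// mul1r.
by rewrite ler_nat.
Qed.

(** [alpha] solves an Euler step for the control that moves the first block to [y1]; independence of
    the rows makes the square block of [B] invertible. *)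
Lemma alphaK k x y1 : (k <= Nt)%N ->
  y1 = usubmx x + dt *: (usubmx (A (t_ k) x) + usubmx (B (t_ k) x) *m alpha k x y1).
Proof.
move=> kN; have := B_rows dynamics x (tk_bounds kN); rewrite row_free_unit => Bu.
rewrite /Defs.alpha mulKVmx// (addrC (usubmx (A _ _))) subrK scalerA divff ?gt_eqF ?dt_gt0//.
by rewrite scale1r addrC subrK.
Qed.

Lemma drift_norm_le t x : 0 <= t <= T -> `|A t x| <= CA T A LA * (1 + `|x|).
Proof.
move=> tT; have LACA : LA <= CA T A LA by rewrite /CA le_max lexx orbT.
have A0 : `|A t 0| <= CA T A LA.
  rewrite /CA le_max; apply/orP; left; apply: ub_le_sup; last by exists t.
  (* The supremum in [CA] bounds [|A t 0|] only once its set is known to be bounded. *)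
  have cA : compact ((fun z : R * D => A z.1 z.2) @` (`[0, T]%classic `*` [set 0])).
    apply: continuous_compact.
      apply: continuous_subspaceW (A_continuous dynamics) => -[u v] /= [].
      by rewrite in_itv.
    by apply: compact_setX; [exact: segment_compact | exact: compact_set1].
  have [M [_ HM]] := compact_bounded cA.
  exists (M + 1) => _ [u uT <-]; apply: (HM (M + 1)); first by rewrite ltrDl.
  by exists (u, 0) => //=; split => //=; rewrite in_itv.
have := A_lipschitz dynamics x 0 tT; rewrite subr0 => AL.
rewrite -(subrK (A t 0) (A t x)); apply: le_trans (ler_normD _ _) _.
rewrite mulrDr mulr1 addrC; apply: lerD => //; apply: le_trans AL _.
exact: ler_wpM2r.
Qed.

Lemma CA_ge0 : 0 <= CA T A LA.
Proof.
by rewrite /CA le_max; apply/orP; right; apply: ltW; exact: LA_gt0 dynamics.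
Qed.

Lemma S2_dist k x y1 y2 : S2 k x y1 y2 -> `|y2 - yy2 k x y1| <= CI * dx.
Proof.
by move=> [gy /(beta_supp beta_basis gy)] /=; rewrite distrC.
Qed.

(** The first block of [y] is exactly that of an Euler step; the second is off by at most [CI * dx],
    the support radius of the basis functions. Hence the radius in [Kset]. *)
Lemma Snext_dist k x y : (k <= Nt)%N -> Snext k x y ->
  `|y - x| <= dt * (CA T A LA * (1 + `|x|) + CB * Chat) + CI * dx.
Proof.
move=> kN [[gy1 al] S2y]; have tT := tk_bounds kN.
set a := alpha k x (usubmx y) in al.
have -> : y - x = dt *: (A (t_ k) x + B (t_ k) x *m a)
    + col_mx 0 (dsubmx y - yy2 k x (usubmx y)).
  rewrite -[LHS]vsubmxK -[RHS]vsubmxK; congr col_mx.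
    rewrite linearB /= [in RHS]linearD /= linearZ /= linearD /= col_mxKu addr0 -mul_usub_mx.
    by rewrite {1}(alphaK x (usubmx y) kN) -/a addrC addKr.
  rewrite linearB /= [in RHS]linearD /= linearZ /= linearD /= col_mxKd -mul_dsub_mx.
  by rewrite /Defs.yy2 -/a opprD [RHS]addrC addrA subrK.
apply: le_trans (ler_normD _ _) _; apply: lerD.
  rewrite normrZ (gtr0_norm dt_gt0) ler_pM2l ?dt_gt0//.
  apply: le_trans (ler_normD _ _) _; apply: lerD; first exact: drift_norm_le.
  apply: le_trans (opnorm_ge _ _) _; apply: ler_pM => //.
  - exact: opnorm_ge0.
  - exact: (B_bounded dynamics x tT).
apply: le_trans (col_mx0_norm_le _ _) _; exact: S2_dist.
Qed.

Lemma S_subset_Kset k : (k <= Nt)%N -> S_ k `<=` Kset k.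
Proof.
elim: k => [|k IH] kN; first by move=> x [].
move=> y [x Sx Sy]; have Kx := IH (ltnW kN) _ Sx.
pose rho := dt * (CA T A LA * (1 + sup [set `|x| | x in Kset k]) + CB * Chat) + CI * dx.
(* The supremum is a genuine one because [Kset k] lies in the compact [K]. *)
have xs : `|x| <= sup [set `|x| | x in Kset k].
  apply: ub_le_sup; last by exists x.
  have [M [_ HM]] := compact_bounded K_compact.
  exists (M + 1) => _ [u Ku <-]; apply: (HM (M + 1)); first by rewrite ltrDl.
  exact: (K_contains (ltnW kN) Ku).
have yx : `|y - x| <= rho.
  apply: le_trans (Snext_dist (ltnW kN) Sy) _; rewrite lerD2r ler_pM2l ?dt_gt0//.
  by rewrite lerD2r ler_wpM2l ?CA_ge0// lerD2l.
have rho0 : 0 < rho.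
  apply: ltr_wpDl; last by rewrite mulr_gt0 ?dx_gt0.
  apply: mulr_ge0; first exact/ltW/dt_gt0.
  apply: addr_ge0; last by apply: mulr_ge0; apply: ltW => //; exact: CB_gt0 dynamics.
  apply: mulr_ge0; first exact: CA_ge0.
  by apply: addr_ge0 => //; apply: le_trans xs.
exists x => //; exists (rho^-1 *: (y - x)) => /=.
  by rewrite normrZ gtr0_norm ?invr_gt0// ler_pdivrMl// mulr1.
by rewrite -/rho scalerA divff ?gt_eqF// scale1r addrC subrK.
Qed.

Lemma S_subset_K k : (k <= Nt)%N -> S_ k `<=` K.
Proof. by move=> kN x /(S_subset_Kset kN)/(K_contains kN). Qed.

Lemma S1_finite k x : (k <= Nt)%N -> finite_set (S1 k x).
Proof.
move=> kN; set c := \sum_i \sum_j `|usubmx (B (t_ k) x) i j|.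
have c0 : 0 <= c by apply: sumr_ge0 => i _; apply: sumr_ge0.
apply: sub_finite_set (grid_ball_finite r
  (`|usubmx x| + dt * (`|usubmx (A (t_ k) x)| + c * Chat)) Ns_gt0).
move=> y1 [gy al]; split=> //=; rewrite {1}(alphaK x y1 kN).
apply: le_trans (ler_normD _ _) _; rewrite lerD2l.
rewrite normrZ (gtr0_norm dt_gt0) ler_pM2l ?dt_gt0//.
apply: le_trans (ler_normD _ _) _; rewrite lerD2l.
by apply: le_trans (mulmx_norm_le _ _) _; apply: ler_wpM2l.
Qed.

Lemma S2_finite k x y1 : finite_set (S2 k x y1).
Proof.
apply: sub_finite_set (grid_ball_finite s (`|yy2 k x y1| + CI * dx) Ns_gt0).
move=> y2 Sy; split; first by case: Sy.
rewrite /= -[y2](subrK (yy2 k x y1)) addrC; apply: le_trans (ler_normD _ _) _.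
by rewrite lerD2l; exact: S2_dist Sy.
Qed.

Lemma Snext_finite k x : (k <= Nt)%N -> finite_set (Snext k x).
Proof.
move=> kN; apply: (@sub_finite_set _ _
  (\bigcup_(y1 in S1 k x) ((fun y2 => col_mx y1 y2) @` S2 k x y1))).
  move=> y [Sy1 Sy2]; exists (usubmx y) => //; exists (dsubmx y) => //.
  exact: vsubmxK.
apply: bigcup_finite; first exact: S1_finite.
by move=> y1 _; apply: finite_image; exact: S2_finite.
Qed.

Lemma S_finite k : (k <= Nt)%N -> finite_set (S_ k).
Proof.
elim: k => [_|k IH kN] /=.
  have [M [_ HM]] := compact_bounded m0_compact.
  apply: sub_finite_set (grid_ball_finite (r + s) (M + 1) Ns_gt0).
  by move=> x [gx /= mx]; split=> //=; apply: (HM (M + 1)) => //; rewrite ltrDl.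
apply: bigcup_finite; first exact/IH/ltnW.
by move=> x _; exact/Snext_finite/ltnW.
Qed.

(** Rounding the uncontrolled Euler position down to the grid moves it by at most [dx]; the control
    that produces this shift has size at most [cK * (dx / dt) <= Chat]. *)
Lemma S1_nonempty k x : (k <= Nt)%N -> S_ k x -> S1 k x !=set0.
Proof.
move=> kN Sx; have tT := tk_bounds kN; have Kx := S_subset_K kN Sx.
pose a := usubmx x + dt *: usubmx (A (t_ k) x).
pose y1 : 'cV[R]_r := \col_i ((Num.floor (a i 0 / dx))%:~R * dx).
have dx0 := dx_gt0; have dt0 := dt_gt0.
have ya : `|y1 - a| <= dx.
  apply: mx_norm_le => [|i j]; first exact: ltW.
  rewrite !ord1 mxE [y1 i 0]mxE [(- a) i 0]mxE; set z := a i 0.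
  have zE : z = z / dx * dx by rewrite divfK ?gt_eqF.
  rewrite [X in _ - X]zE -mulrBl normrM (gtr0_norm dx0) ler_piMl ?(ltW dx0)//.
  have /andP[h1 h2] := floor_itv (z / dx).
  by rewrite ler_norml; rewrite intrD in h2; apply/andP; split; lra.
exists y1; split; first by move=> i; exists (Num.floor (a i 0 / dx)); rewrite mxE.
have -> : alpha k x y1 = invmx (usubmx (B (t_ k) x)) *m (dt^-1 *: (y1 - a)).
  rewrite /Defs.alpha; congr (_ *m _); rewrite /a opprD addrA [RHS]scalerBr.
  by rewrite scalerA mulVf ?gt_eqF// scale1r.
apply: le_trans (opnorm_ge _ _) _.
rewrite normrZ gtr0_norm ?invr_gt0//.
apply: (@le_trans _ _ (cK * (dx / dt))); last first.
  by rewrite mulrC -ler_pdivlMr.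
apply: ler_pM => //.
- exact: opnorm_ge0.
- by rewrite mulr_ge0// invr_ge0 ltW.
- exact: cK_bound.
- by rewrite mulrC ler_pM2r// invr_gt0.
Qed.

(** The basis function of a grid point outside [S2] vanishes at [yy2], so the partition of unity
    loses nothing. *)
Lemma S2_weights k x y1 :
  \sum_(y2 \in S2 k x y1) beta Ns y2 (yy2 k x y1) = 1.
Proof.
rewrite -(beta_sum1 beta_basis (yy2 k x y1)).
apply: fsbig_widen; first by move=> y2 [].
move=> y2 [gy /= nS]; apply/eqP; apply/negPn/negP => b0; apply: nS.
by split=> //; apply: subset_closure.
Qed.

End Reachable.
(** * The scheme as a finite mean field game *)

Section CostLemmas.
Context {R : realType} (n : nat).
Local Notation D := 'cV[R]_n.

Lemma lipschitz_continuous (h : D -> R) :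
  (exists2 L : R, 0 < L & forall x y, `|h x - h y| <= L * `|x - y|) -> continuous h.
Proof.
move=> [L L0 hL] x; have Fx := @nbhs_filter D x; apply/cvgrPdist_lt => e e0.
have := nbhsx_ballx x _ (divr_gt0 e0 L0); rewrite -ball_normE.
apply: filterS => y xy; apply: le_lt_trans (hL x y) _.
by rewrite mulrC -ltr_pdivlMr.
Qed.

Lemma in_P_weights (S : set D) (q : D -> R) : finite_set S ->
  in_P S q <-> weights (fset_set S : seq D) q.
Proof.
move=> fS; rewrite /in_P /weights -fsbig_finite//.
split=> -[q0 qo q1]; split=> // x; last move=> nS.
  by rewrite in_fset_set// => xS; apply: qo => /mem_set; rewrite (negbTE xS).
by apply: qo; rewrite in_fset_set//; apply/negP => /set_mem.
Qed.

Lemma monotone_weights (Phi : D -> prob R n -> R) (s : seq D) (q q' : D -> R) :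
  (forall mu1 mu2 : prob R n, in_P1 mu1 -> in_P1 mu2 ->
    0 <= \int[mu1]_(x in setT) (Phi x mu1 - Phi x mu2)
         - \int[mu2]_(x in setT) (Phi x mu1 - Phi x mu2)) ->
  (forall mu, in_P1 mu -> continuous (Phi ^~ mu)) ->
  uniq s -> weights s q -> weights s q' ->
  0 <= \sum_(x <- s) (Phi x (measure_of q) - Phi x (measure_of q')) * (q x - q' x).
Proof.
move=> mon cPhi us wq wq'.
have P1 := measure_of_P1 us wq; have P1' := measure_of_P1 us wq'.
have cB : continuous (fun x => Phi x (measure_of q) - Phi x (measure_of q')).
  by move=> x; exact: (cvgB (cPhi _ P1 x) (cPhi _ P1' x)).
have := mon _ _ P1 P1'.
rewrite (Rintegral_measure_of us wq cB) (Rintegral_measure_of us wq' cB) -sumrB.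
by under eq_bigr do rewrite -mulrBl mulrC.
Qed.

Lemma d1_continuous_segment (Phi : prob R n -> R) (s : seq D) (q q' : D -> R) :
  uniq s -> weights s q -> weights s q' ->
  (forall e : R, 0 < e -> exists2 del : R, 0 < del & forall mu, in_P1 mu ->
     (d1 mu (measure_of q) < del%:E)%E -> `|Phi mu - Phi (measure_of q)| < e) ->
  Phi (measure_of (segment t q q')) @[t --> 0^'+] --> Phi (measure_of q).
Proof.
move=> us wq wq' cPhi; apply/cvgrPdist_lt => e e0.
have [del del0 Hdel] := cPhi _ e0.
set C := \sum_(x <- s) \sum_(y <- s) q' x * q y * `|x - y|.
have C0 : 0 <= C.
  have [q0 _ _] := wq; have [q'0 _ _] := wq'.
  by apply: sumr_ge0 => x _; apply: sumr_ge0 => y _; rewrite !mulr_ge0.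
near=> t; rewrite distrC; apply: Hdel.
  apply: (measure_of_P1 us); apply: weights_segment => //.
  by apply/andP; split; near: t; [exact: nbhs_right_ge | exact: nbhs_right_le].
apply: le_lt_trans (d1_segment us wq wq' _) _.
  by apply/andP; split; near: t; [exact: nbhs_right_ge | exact: nbhs_right_le].
rewrite lte_fin -/C; apply: (@le_lt_trans _ _ (t * (C + 1))).
  by rewrite ler_wpM2l ?lerDl//; near: t; exact: nbhs_right_ge.
rewrite -ltr_pdivlMr ?ltr_wpDl//; near: t; apply: nbhs_right_lt.
by rewrite divr_gt0// ltr_wpDl.
Unshelve. all: by end_near. Qed.

End CostLemmas.

Lemma inf_attained (R : realType) (E : set R) m : E m -> lbound E m -> inf E = m.
Proof.
move=> Em lb; apply/eqP; rewrite eq_le; apply/andP; split.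
  by apply: ge_inf => //; exists m.
by apply: lb_le_inf => //; exists m.
Qed.

Section Scheme.
Context {R : realType} (T : R) (r s : nat).
Local Notation D := 'cV[R]_(r + s).
Variables (A : R -> D -> D) (B : R -> D -> 'M[R]_(r + s, r)) (LA CB : R).
Variables (ell : R -> 'cV[R]_r -> D -> prob R (r + s) -> R).
Variables (g : D -> prob R (r + s) -> R).
Variables (ell0 : R -> 'cV[R]_r -> D -> R) (f : R -> D -> prob R (r + s) -> R).
Variables (m0 : prob R (r + s)) (Chat CI eps : R).
Variable beta : nat -> 'cV[R]_s -> 'cV[R]_s -> R.
Variables (Nt Ns : nat).

Local Notation dt := (dt T Nt).
Local Notation t_ := (tk T Nt).
Local Notation alpha := (alpha T A B Nt).
Local Notation yy2 := (yy2 T A B Nt).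
Local Notation S1 := (S1 T A B Chat Nt Ns).
Local Notation S2 := (S2 T A B beta Nt Ns).
Local Notation Snext := (Snext T A B Chat beta Nt Ns).
Local Notation S_ := (S_ T A B m0 LA CB CI Chat beta Nt Ns).
Local Notation Mhat0 := (Mhat0 T A B m0 LA CB CI Chat beta Nt Ns).

Hypothesis dt_gt0 : 0 < dt.
Hypothesis t_bounds : forall k, (k <= Nt)%N -> 0 <= t_ k <= T.
Hypothesis eps_gt0 : 0 < eps.
Hypothesis ellE : forall (t : R) (a : 'cV[R]_r) (x : D) mu, 0 <= t <= T ->
  in_P1 mu -> ell t a x mu = ell0 t a x + f t x mu.
Hypothesis f_hyp : coupling_cost_hyp T f.
Hypothesis g_hyp : final_cost_hyp g.
Hypothesis g_monotone : monotone_cost g.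
Hypothesis beta_basis : Q1_basis Ns CI (beta Ns).
Hypothesis S_fin : forall k, (k <= Nt)%N -> finite_set (S_ k).
Hypothesis S1_fin : forall k x, (k <= Nt)%N -> finite_set (S1 k x).
Hypothesis S1_neq0 : forall k x, (k <= Nt)%N -> S_ k x -> S1 k x !=set0.
Hypothesis S2_sum : forall k x y1,
  \sum_(y2 \in S2 k x y1) beta Ns y2 (yy2 k x y1) = 1.
Hypothesis Mhat0_P : in_P (S_ 0) Mhat0.

Definition states k : seq D := fset_set (S_ k).
Definition actions k x : seq 'cV[R]_r := fset_set (S1 k x).

(** An action is the first block of the state it reaches; only the second block is random,
    distributed by the basis functions. *)
Definition transition k x (a : 'cV[R]_r) (y : D) : R :=
  if (y \in Snext k x) && (usubmx y == a) then
    beta Ns (dsubmx y) (yy2 k x a)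
  else 0.

Definition control_cost k x a : R := dt * ell0 (t_ k) (alpha k x a) x.

(** The final cost is treated as the coupling at time [Nt], so that [f] and [g] fall under one
    monotonicity and one continuity condition. *)
Definition crowd_cost k (m : D -> R) x : R :=
  if (k < Nt)%N then dt * f (t_ k) x (measure_of m) else g x (measure_of m).

Local Notation qval := (qvalue states transition control_cost crowd_cost).
Local Notation vback := (value_back Nt states actions transition control_cost crowd_cost eps).
Local Notation pol := (policy Nt states actions transition control_cost crowd_cost eps).
Local Notation law := (dist states actions transition Mhat0).

Lemma states_uniq k : uniq (states k). Proof. exact: fset_uniq. Qed.

Lemma actions_uniq k x : uniq (actions k x). Proof. exact: fset_uniq. Qed.

Lemma mem_states k x : (k <= Nt)%N -> x \in states k <-> S_ k x.
Proof.
by move=> kN; rewrite /states in_fset_set; [split; [exact: set_mem|exact: mem_set] | exact: S_fin].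
Qed.

Lemma mem_actions k x a : (k <= Nt)%N -> a \in actions k x <-> S1 k x a.
Proof.
by move=> kN; rewrite /actions in_fset_set; [split; [exact: set_mem|exact: mem_set] | exact: S1_fin].
Qed.

Lemma actions_neq0 k x : (k < Nt)%N -> x \in states k -> actions k x != [::].
Proof.
move=> kN /(mem_states _ (ltnW kN)) Sx.
have [a /(mem_actions x a (ltnW kN)) aA] := S1_neq0 (ltnW kN) Sx.
by apply/eqP => E; rewrite E in aA.
Qed.

Lemma transition_interp k x a (W : D -> R) : (k < Nt)%N -> S_ k x -> S1 k x a ->
  \sum_(y <- states k.+1) transition k x a y * W y =
  interp (beta Ns) (S2 k x a) (fun y2 => W (col_mx a y2)) (yy2 k x a).
Proof.
move=> kN Sx Sa; rewrite -fsbig_finite; last exact: S_fin.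
have inS y2 : S2 k x a y2 -> Snext k x (col_mx a y2).
  by move=> Sy; split; rewrite ?col_mxKu ?col_mxKd.
transitivity (\sum_(y \in (fun y2 => col_mx a y2) @` S2 k x a) transition k x a y * W y).
  symmetry; apply: fsbig_widen; first by move=> _ [y2 Sy <-]; exists x => //; exact: inS.
  move=> y [_ nimg]; apply/eqP; apply/negPn/negP; rewrite /transition.
  case: ifP => [/andP[/set_mem yN /eqP ya] _|_]; last by rewrite mul0r eqxx.
  have [_ S2y] := yN.
  apply: nimg; exists (dsubmx y); last by rewrite -ya vsubmxK.
  by rewrite -ya.
rewrite fsbig_image; last by move=> y y' _ _ /eq_col_mx[].
apply: eq_fsbigr => y2 /set_mem Sy; rewrite /transition.
by rewrite (mem_set (inS _ Sy)) col_mxKu eqxx col_mxKd.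
Qed.

Lemma transition_ge0 k x a y : (k < Nt)%N -> x \in states k -> a \in actions k x ->
  0 <= transition k x a y.
Proof.
move=> kN _ _; rewrite /transition; case: ifP => // /andP[/set_mem yN _]; have [_ [gy _]] := yN.
exact: beta_ge0 beta_basis _ _ gy.
Qed.

Lemma transition_sum k x a : (k < Nt)%N -> x \in states k -> a \in actions k x ->
  \sum_(y <- states k.+1) transition k x a y = 1.
Proof.
move=> kN /(mem_states _ (ltnW kN)) Sx /(mem_actions _ _ (ltnW kN)) Sa.
have := transition_interp (fun=> 1) kN Sx Sa.
under eq_bigr do rewrite mulr1.
move=> ->; rewrite /interp -[RHS](S2_sum k x a).
by apply: eq_fsbigr => y2 _; rewrite mulr1.
Qed.

Lemma transition_out k x a y : (k < Nt)%N -> x \in states k -> a \in actions k x ->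
  y \notin states k.+1 -> transition k x a y = 0.
Proof.
move=> kN /(mem_states _ (ltnW kN)) Sx _ yS; rewrite /transition.
case: ifP => // /andP[/set_mem yN _]; case/negP: yS.
by apply/mem_states => //; exists x.
Qed.

Lemma Mhat0_weights : weights (states 0) Mhat0.
Proof. by apply/in_P_weights => //; exact: S_fin. Qed.

Lemma f_cont t mu : 0 <= t <= T -> in_P1 mu -> continuous (fun x => f t x mu).
Proof.
move=> tT P1; apply: lipschitz_continuous.
by have [L L0 HL] := f_lipschitz f_hyp; exists L => // x y; exact: HL.
Qed.

Lemma g_cont mu : in_P1 mu -> continuous (fun x => g x mu).
Proof.
move=> P1; apply: lipschitz_continuous.
by have [L L0 HL] := g_lipschitz g_hyp; exists L => // x y; exact: HL.
Qed.

Lemma crowd_cost_monotone k m m' : (k <= Nt)%N ->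
  weights (states k) m -> weights (states k) m' ->
  0 <= \sum_(x <- states k) (crowd_cost k m x - crowd_cost k m' x) * (m x - m' x).
Proof.
move=> kN wm wm'; rewrite /crowd_cost; case: (k < Nt)%N; last first.
  exact: (monotone_weights g_monotone g_cont (states_uniq k) wm wm').
under eq_bigr do rewrite -mulrBr -mulrA.
rewrite -mulr_sumr; apply: mulr_ge0; first exact: ltW.
have f_cont_k mu := @f_cont _ mu (t_bounds kN).
exact: (monotone_weights (f_monotone f_hyp (t_bounds kN)) f_cont_k (states_uniq k) wm wm').
Qed.

Lemma crowd_cost_segment k m m' x : (k <= Nt)%N ->
  weights (states k) m -> weights (states k) m' -> x \in states k ->
  crowd_cost k (segment t m m') x @[t --> 0^'+] --> crowd_cost k m x.
Proof.
move=> kN wm wm' _; have P1 := measure_of_P1 (states_uniq k) wm.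
rewrite /crowd_cost; case: (k < Nt)%N; last first.
  apply: (@d1_continuous_segment R (r + s) (g x) (states k)) => //; first exact: states_uniq.
  move=> e e0; have [del del0 Hdel] := g_continuous g_hyp x P1 e0.
  by exists del => // mu P1mu dmu; apply: Hdel => //; rewrite subrr normr0.
apply: cvgMr.
apply: (@d1_continuous_segment R (r + s) (f (t_ k) x) (states k)) => //; first exact: states_uniq.
move=> e e0; have tT := t_bounds kN.
have [del del0 Hdel] := f_continuous f_hyp x tT P1 e0.
by exists del => // mu P1mu dmu; apply: Hdel => //; rewrite subrr normr0.
Qed.

(** * Identification of the scheme with the finite game *)

Section Link.
Variables (M : 'I_Nt.+1 -> D -> R) (Mn : nat -> D -> R).
Hypothesis MMn : forall k, (k <= Nt)%N -> M (inord k) = Mn k.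
Hypothesis Mn_weights : forall k, (k <= Nt)%N -> weights (states k) (Mn k).

Local Notation stage := (stage_cost T A B ell Chat eps beta Ns M).

Lemma stage_costE k W x q : (k < Nt)%N -> S_ k x -> stage k W x q =
  \sum_(a <- actions k x) q a * qval Mn k W x a
  + eps * \sum_(a <- actions k x) q a * ln (q a).
Proof.
move=> kN Sx; have fin1 := S1_fin x (ltnW kN).
rewrite /stage_cost /entropy !fsbig_finite//; congr (_ + _).
apply: eq_big_seq => a aA; congr (_ * _).
have /(mem_actions x a (ltnW kN)) Sa := aA.
rewrite /qvalue (transition_interp W kN Sx Sa) /Mmeas MMn ?(ltnW kN)//.
(* Separability is available for measures with finite first moment, whence the recourse to
   [Mn_weights]. *)
congr (_ + _); rewrite /control_cost /crowd_cost kN ellE ?mulrDr//.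
  exact/t_bounds/ltnW.
exact: measure_of_P1 (states_uniq k) (Mn_weights (ltnW kN)).
Qed.

(** [VbackE] identifies the two value functions on reachable states only; expectations are sums over
    these. *)
Lemma qvalue_ext k W W' x : (k < Nt)%N -> (forall y, S_ k.+1 y -> W y = W' y) ->
  qval Mn k W x =1 qval Mn k W' x.
Proof.
move=> kN WW' a; rewrite /qvalue; congr (_ + _).
by apply: eq_big_seq => y /(mem_states y kN) Sy; rewrite WW'.
Qed.

Lemma in_P_actions k x q : (k <= Nt)%N ->
  in_P (S1 k x) q <-> weights (actions k x) q.
Proof. by move=> kN; apply: in_P_weights; exact: S1_fin. Qed.

Lemma softargmin_weights h k x : (k < Nt)%N -> S_ k x ->
  weights (actions k x) (softargmin eps h (actions k x)).
Proof.
move=> kN Sx; split; first exact: softargmin_ge0.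
  exact: softargmin_out.
by apply: softargmin_sum => //; apply: actions_neq0 => //; apply/mem_states => //; exact: ltnW.
Qed.

Lemma actions_neq0_S k x : (k < Nt)%N -> S_ k x -> actions k x != [::].
Proof. by move=> kN Sx; apply: actions_neq0 => //; apply/mem_states => //; exact: ltnW. Qed.

Lemma stage_cost_inf k W x : (k < Nt)%N -> S_ k x ->
  inf [set stage k W x q | q in in_P (S1 k x)] =
  softmin eps (qval Mn k W x) (actions k x).
Proof.
move=> kN Sx; have A0 := actions_neq0_S kN Sx.
apply: inf_attained.
  exists (softargmin eps (qval Mn k W x) (actions k x)).
    by apply/in_P_actions; [exact: ltnW | exact: softargmin_weights].
  by rewrite stage_costE// softmin_attained.
move=> _ [q /(in_P_actions _ _ (ltnW kN))[q0 _ q1] <-].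
by rewrite stage_costE//; exact: softmin_le.
Qed.

Lemma VbackE n x : (n <= Nt)%N -> S_ (Nt - n) x ->
  Vback T A B ell g Chat eps beta Ns M n x = vback Mn n x.
Proof.
elim: n x => [|n IH] x nN Sx.
  by rewrite /= /crowd_cost ltnn /Mmeas MMn.
have kN : (Nt - n.+1 < Nt)%N by rewrite ltn_subrL; exact: leq_ltn_trans nN.
have kS : (Nt - n.+1).+1 = (Nt - n)%N by rewrite -subSn// subSS.
rewrite /= stage_cost_inf//; apply: softmin_ext => a _.
by apply: qvalue_ext => // y; rewrite kS => Sy; apply: IH => //; exact: ltnW.
Qed.

(** [get] returns some minimiser; [softmin_unique] determines it on the actions, and both sides
    vanish elsewhere. *)
Lemma pME k x : (k < Nt)%N -> S_ k x ->
  pM T A B ell g Chat eps beta Ns M k x = pol Mn k x.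
Proof.
move=> kN Sx; have A0 := actions_neq0_S kN Sx.
set W := V T A B ell g Chat eps beta Ns M k.+1.
have polE : pol Mn k x = softargmin eps (qval Mn k W x) (actions k x).
  apply/funext => a; apply: softargmin_ext => b _; apply: qvalue_ext => // y Sy.
  by rewrite /W /V VbackE ?leq_subr// subKn.
have pol_w := softargmin_weights (qval Mn k W x) kN Sx.
have pol_min q : in_P (S1 k x) q ->
    stage k W x (softargmin eps (qval Mn k W x) (actions k x)) <= stage k W x q.
  move=> /(in_P_actions _ _ (ltnW kN))[q0 _ q1].
  by rewrite !stage_costE// softmin_attained//; exact: softmin_le.
have [|pP pmin] := @getPex _ [set q | in_P (S1 k x) q /\ forall q', in_P (S1 k x) q' ->
        stage k W x q <= stage k W x q'].
  exists (softargmin eps (qval Mn k W x) (actions k x)); split=> //.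
  by apply/in_P_actions => //; exact: ltnW.
rewrite /pM -/W; set p := get _ in pP pmin *.
have /(in_P_actions _ _ (ltnW kN))[p0 po p1] := pP.
have le := pmin _ ((in_P_actions _ _ (ltnW kN)).2 pol_w).
rewrite !stage_costE// softmin_attained// in le.
rewrite polE; apply/funext => a.
have [aA|aA] := boolP (a \in actions k x); first exact: softmin_unique le _ aA.
by rewrite po// softargmin_out.
Qed.

Lemma MhatE k : (k <= Nt)%N ->
  Mhat T A B ell g m0 LA CB CI Chat eps beta Ns M k = law (pol Mn) k.
Proof.
elim: k => [//|k IH] kN; apply/funext => y /=; rewrite -/(S_ k).
rewrite fsbig_finite; last exact/S_fin/ltnW.
apply: eq_big_seq => x xS; have /(mem_states x (ltnW kN)) Sx := xS.
rewrite IH ?(ltnW kN)// /PM pME//; case: ifPn => [yN|yN]; last first.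
  by rewrite mul0r big1// => a _; rewrite /transition (negbTE yN) mulr0.
have yA : usubmx y \in actions k x.
  by apply/mem_actions; [exact: ltnW | have [] := set_mem yN].
(* Only the action equal to the first block of [y] can lead to [y]. *)
rewrite (bigD1_seq _ yA (actions_uniq k x)) /= big1 ?addr0; last first.
  by move=> a; rewrite eq_sym => /negbTE ya; rewrite /transition yN ya mulr0.
by rewrite /transition yN eqxx /=; ring.
Qed.

End Link.

Theorem scheme_unique_equilibrium : exists! M : 'I_Nt.+1 -> D -> R,
  MM T A B m0 LA CB CI Chat beta Nt Ns M /\
  M = br T A B ell g m0 LA CB CI Chat eps beta Nt Ns M.
Proof.
have [Mn Mfix] := finite_mfg_exists control_cost eps_gt0 actions_neq0 transition_ge0
  transition_sum transition_out Mhat0_weights crowd_cost_monotone crowd_cost_segment.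
have MnM k : (k <= Nt)%N -> Mn (inord k : 'I_Nt.+1) = Mn k by move=> kN; rewrite inordK.
exists (fun k : 'I_Nt.+1 => Mn k); split.
  split=> [k|].
    by apply/in_P_weights; [apply: S_fin; exact: leq_ord | have [] := Mfix k (leq_ord k)].
  apply/funext => k; rewrite /br (MhatE MnM) ?leq_ord//; last by move=> j /Mfix[].
  by have [] := Mfix k (leq_ord k).
move=> M [MP Mbr].
have MN k : (k <= Nt)%N -> M (inord k) = (fun j => M (inord j)) k by [].
have Mw k : (k <= Nt)%N -> weights (states k) (M (inord k)).
  move=> kN; apply/in_P_weights; first exact: S_fin.
  by have := MP (inord k); rewrite inordK.
have fM j (jN : (j <= Nt)%N) : Mn j = law (pol Mn) j := (Mfix j jN).2.
have fM' j : (j <= Nt)%N -> M (inord j) = law (pol (fun i => M (inord i))) j.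
  by move=> jN; rewrite -(MhatE MN Mw jN) {1}Mbr /br inordK.
apply/funext => k; rewrite -[in RHS](inord_val k).
exact: (finite_mfg_unique eps_gt0 actions_neq0 transition_ge0 transition_sum
  transition_out Mhat0_weights crowd_cost_monotone (M := Mn)
  (M' := fun i => M (inord i)) fM fM' (leq_ord k)).
Qed.

End Scheme.

Theorem proposition4p2 (R : realType) (T p : R) (r s : nat)
  (T_gt0 : 0 < T) (p_gt1 : 1 < p) (r_ge1 : (1 <= r)%N)
  (* admissible, separable and monotone data *)
  (A : R -> 'cV[R]_(r + s) -> 'cV[R]_(r + s))
  (B : R -> 'cV[R]_(r + s) -> 'M[R]_(r + s, r))
  (ell : R -> 'cV[R]_r -> 'cV[R]_(r + s) -> prob R (r + s) -> R)
  (g : 'cV[R]_(r + s) -> prob R (r + s) -> R)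
  (LA CB : R)
  (dynamics : dynamics_hyp T A B LA CB)
  (running_cost : running_cost_hyp T p ell)
  (final_cost : final_cost_hyp g)
  (sep_mon : separable_monotone T p ell g)
  (* initial distribution *)
  (m0 : prob R (r + s)) (m0_compact : compact (msupp m0))
  (* the constants Chat, C_I, c_K, the compact set K and the Q1 bases *)
  (Chat : R) (Chat_bound : control_bound T A B ell g Chat)
  (CI : R) (CI_gt0 : 0 < CI)
  (beta : nat -> 'cV[R]_s -> 'cV[R]_s -> R)
  (beta_basis : forall Ns, (0 < Ns)%N -> Q1_basis Ns CI (beta Ns))
  (K : set 'cV[R]_(r + s)) (K_compact : compact K)
  (K_contains : forall Nt Ns, (0 < Nt)%N -> (0 < Ns)%N -> dx Ns <= dt T Nt ->
     forall k, (k <= Nt)%N -> Kset T A m0 LA CB CI Chat Nt Ns k `<=` K)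
  (cK : R) (cK_gt0 : 0 < cK)
  (cK_bound : forall (t : R) x, 0 <= t <= T -> K x ->
     opnorm (invmx (usubmx (B t x))) <= cK)
  (* discretization parameters *)
  (Nt Ns : nat) (NtNs_admissible : admissible_parameters T m0 Chat Nt Ns cK)
  (eps : R) (eps_gt0 : 0 < eps)
  (* the initial weights m0(E(x)), x in S_0, form an element of P(S_0), so
     that br takes its values in the product of the P(S_k) *)
  (Mhat0_in_P :
     in_P (S_ T A B m0 LA CB CI Chat beta Nt Ns 0)
          (Mhat0 T A B m0 LA CB CI Chat beta Nt Ns)) :
  exists! M : 'I_Nt.+1 -> 'cV[R]_(r + s) -> R,
    MM T A B m0 LA CB CI Chat beta Nt Ns M /\
    M = br T A B ell g m0 LA CB CI Chat eps beta Nt Ns M.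
Proof.
case: NtNs_admissible => Nt0 Ns0; rewrite le_min => /andP[dxdt1 dxdtK] _.
case: Chat_bound => Chat0 _.
case: sep_mon => ell0 [f [ellE _ f_hyp g_mon]].
have dt0 := dt_gt0 T_gt0 Nt0.
(* The bound by 1 places the sets [Kset] inside [K]; the bound by [Chat / cK] makes the action sets
   nonempty. *)
have dxdt : dx Ns <= dt T Nt by rewrite -[leRHS]mul1r -ler_pdivrMr.
have Kc k (kN : (k <= Nt)%N) := K_contains _ _ Nt0 Ns0 dxdt k kN.
have basis := beta_basis _ Ns0.
apply: (scheme_unique_equilibrium dt0 _ eps_gt0 ellE f_hyp final_cost g_mon basis) => //.
- by move=> k; exact: tk_bounds.
- exact: (S_finite Chat T_gt0 dynamics m0_compact basis Nt0 Ns0).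
- exact: (S1_finite Chat T_gt0 dynamics Nt0 Ns0).
- exact: (S1_nonempty T_gt0 dynamics Chat0 CI_gt0 basis K_compact Kc cK_gt0
            cK_bound Nt0 Ns0 dxdtK).
- by move=> k x y1; exact: S2_weights basis _ _ _.
Qed.
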